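(* Let $L\subset\overline{k}$ be a finite extension of $k$, $n\in\mathbb{Z}_{>0}$, and $P_i=(p^{[i]}_{n-1},\dots,p^{[i]}_0)^{\mathrm{tr}}\in\mathbf{C}^{\otimes n}(L)$ for $1\le i\le\ell$. Set $\mathbf{f}_i:=p^{[i]}_0+p^{[i]}_1(t-\theta)+\cdots+p^{[i]}_{n-1}(t-\theta)^{n-1}\in L[t]$. Suppose that (1) $\mathbf{f}_1,\dots,\mathbf{f}_\ell$ are linearly independent over $\mathbb{F}_q[t]$; (2) $\mathrm{ord}_w(\mathbf{f}_i)>0$ for all $i$ and all places $w$ of $L$ with $w\mid\infty$; (3) $\mathrm{ord}_w(\mathbf{f}_i)\ge1-q$ for all $i$ and all places $w$ of $L$ with $w\nmid\infty$. Then $\mathrm{rank}_{\mathbb{F}_q[t]}\mathrm{Span}_{\mathbb{F}_q[t]}\{P_1,\dots,P_\ell\}=\ell$. In particular, $\dim_{\mathbb{F}_q(t)}\mathbf{C}^{\otimes n}(L)\otimes_{\mathbb{F}_q[t]}\mathbb{F}_q(t)=\aleph_0$.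
   Context: Let $q$ be a prime power, $k=\mathbb{F}_q(\theta)$, $\overline{k}$ an algebraic closure of $k$, $t$ a variable independent of $\theta$. For a place $w$ of $L$ with normalized valuation $\mathrm{ord}_w$ and $\mathbf{f}=\sum_if_it^i\in L[t]$, $\mathrm{ord}_w(\mathbf{f})=\min_i\mathrm{ord}_w(f_i)$; $w\mid\infty$ means $w$ lies above the infinite place $1/\theta$ of $k$. The $n$-th tensor power of the Carlitz module $\mathbf{C}^{\otimes n}$ is $\mathbb{G}_a^n$ with the $\mathbb{F}_q$-algebra homomorphism $[\cdot]_n:\mathbb{F}_q[t]\to\mathrm{Mat}_n(k[\tau])$ determined by $[t]_n=\theta I_n+N+\tau E_{n,1}$, where $k[\tau]$ is the twisted polynomial ring ($\tau\alpha=\alpha^q\tau$) acting on column vectors coordinatewise by $\tau(x)=x^q$, $N$ has $1$'s on the superdiagonal and $0$ elsewhere, and $E_{n,1}$ is the matrix unit at $(n,1)$; $\mathbf{C}^{\otimes n}(L)=L^n$ is an $\mathbb{F}_q[t]$-module via $a\cdot P=[a]_n(P)$. *)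

(* Defs.v *)
From HB Require Import structures.
From mathcomp Require Import all_boot all_order all_fingroup all_solvable.
From mathcomp Require Import all_algebra all_field.
From mathcomp Require Import generic_quotient ring_quotient.
From mathcomp Require Import boolp constructive_ereal.
From mathcomp Require Import zify.
From mathcomp.multinomials Require Import freeg.

Set Implicit Arguments.
Unset Strict Implicit.
Unset Printing Implicit Defensive.
Import Order.TTheory GRing.Theory Num.Theory.
Local Open Scope ring_scope.
Local Open Scope quotient_scope.

(* Independence of a family, possibly infinite: every finite sub-family is
   independent. *)
Definition lin_indep (R : nzRingType) (M : lmodType R) (I : eqType)
    (e : I -> M) : Prop :=
  forall (s : seq I) (a : I -> R), uniq s ->
    \sum_(i <- s) a i *: e i = 0 -> {in s, forall i, a i = 0}.

Definition is_basis (R : nzRingType) (M : lmodType R) (I : eqType)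
    (e : I -> M) : Prop :=
  lin_indep e /\
  forall v : M, exists (s : seq I) (a : I -> R), v = \sum_(i <- s) a i *: e i.

Definition dim_aleph0 (K : fieldType) (V : lmodType K) : Prop :=
  exists e : nat -> V, is_basis e.

Definition span_of (R : nzRingType) (M : lmodType R) (l : nat)
    (e : 'I_l -> M) (x : M) : Prop :=
  exists a : 'I_l -> R, x = \sum_(i < l) a i *: e i.

(* The rank of a submodule S of M over a domain is r: the maximal size of an
   independent family of elements of S. *)
Definition has_rank (R : idomainType) (M : lmodType R) (S : M -> Prop)
    (r : nat) : Prop :=
  (exists e : 'I_r -> M, (forall i, S (e i)) /\ lin_indep e) /\
  (forall (m : nat) (e : 'I_m -> M),
     (forall i, S (e i)) -> lin_indep e -> (m <= r)%N).

(* B viewed as a module over A through phi : A -> B. *)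
Definition restrict_scalars (A B : nzRingType) (phi : {rmorphism A -> B}) :
  Type := B.

Section RestrictScalars.
Variables (A B : nzRingType) (phi : {rmorphism A -> B}).

HB.instance Definition _ := GRing.Zmodule.on (restrict_scalars phi).

Definition rs_scale (a : A) (b : restrict_scalars phi) : restrict_scalars phi :=
  phi a * (b : B).

Fact rs_scaleA a b v : rs_scale a (rs_scale b v) = rs_scale (a * b) v.
Proof. by rewrite /rs_scale rmorphM mulrA. Qed.
Fact rs_scale1 : left_id 1 rs_scale.
Proof. by move=> v; rewrite /rs_scale rmorph1 mul1r. Qed.
Fact rs_scaleDr : right_distributive rs_scale +%R.
Proof. by move=> a u v; rewrite /rs_scale mulrDr. Qed.
Fact rs_scaleDl v : {morph rs_scale^~ v : a b / a + b}.
Proof. by move=> a b; rewrite /rs_scale rmorphD mulrDl. Qed.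

HB.instance Definition _ := GRing.Zmodule_isLmodule.Build A
  (restrict_scalars phi) rs_scaleA rs_scale1 rs_scaleDr rs_scaleDl.
End RestrictScalars.

(* base_change phi M is the tensor product M (x)_A B as a B-module: the free
   abelian group on M x B modulo the subgroup generated by the bilinearity and
   A-balancing relations. *)
Section BaseChange.
Variables (A B : comNzRingType) (phi : {rmorphism A -> B}) (M : lmodType A).
Local Notation FG := {freeg (M * B)%type}.

Inductive tensor_rel : FG -> Prop :=
| TensorRel0 : tensor_rel 0
| TensorRelB x y : tensor_rel x -> tensor_rel y -> tensor_rel (x - y)
| TensorRelDl m m' b :
    tensor_rel (<< (m + m', b) >> - << (m, b) >> - << (m', b) >>)
| TensorRelDr m b b' :
    tensor_rel (<< (m, b + b') >> - << (m, b) >> - << (m, b') >>)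
| TensorRelZ a m b :
    tensor_rel (<< (a *: m, b) >> - << (m, phi a * b) >>).

Definition tensor_relb : {pred FG} := fun x => `[< tensor_rel x >].

Fact tensor_relb_zmod : zmod_closed tensor_relb.
Proof.
split; first exact/asboolP/TensorRel0.
by move=> x y /asboolP hx /asboolP hy; apply/asboolP/TensorRelB.
Qed.

HB.instance Definition _ :=
  GRing.isZmodClosed.Build FG tensor_relb tensor_relb_zmod.

Definition base_change : Type := Quotient.quot tensor_relb.

HB.instance Definition _ := GRing.Zmodule.on base_change.
HB.instance Definition _ := EqQuotient.on base_change.

Definition tensor (m : M) (b : B) : base_change :=
  \pi_(Quotient.quot tensor_relb) << (m, b) >>.

Definition bc_pre_scale (c : B) : FG -> FG :=
  fglift (fun mb : M * B => << (mb.1, c * mb.2) >> : FG).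

Definition bc_scale (c : B) (x : base_change) : base_change :=
  \pi_(Quotient.quot tensor_relb)
    (bc_pre_scale c (repr (x : Quotient.quot tensor_relb))).

Fact bc_pre_scaleU c m b : bc_pre_scale c << (m, b) >> = << (m, c * b) >>.
Proof. by rewrite /bc_pre_scale liftU scale1r. Qed.

Fact bc_pre_scaleB c : {morph bc_pre_scale c : x y / x - y}.
Proof. by move=> x y; exact: lift_is_additive. Qed.

Fact bc_pre_scale0 c : bc_pre_scale c 0 = 0.
Proof. by rewrite -[X in bc_pre_scale _ X](subrr 0) bc_pre_scaleB subrr. Qed.

Fact bc_pre_scaleD c : {morph bc_pre_scale c : x y / x + y}.
Proof.
move=> x y; rewrite -{1}[y]opprK bc_pre_scaleB -(sub0r y) bc_pre_scaleB.
by rewrite bc_pre_scale0 sub0r opprK.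
Qed.

Fact bc_pre_scale_rel c x : tensor_rel x -> tensor_rel (bc_pre_scale c x).
Proof.
elim=> [|{}x y _ hx _ hy|m m' b|m b b'|a m b].
- by rewrite bc_pre_scale0; apply: TensorRel0.
- by rewrite bc_pre_scaleB; apply: TensorRelB.
- by rewrite !bc_pre_scaleB !bc_pre_scaleU; apply: TensorRelDl.
- by rewrite !bc_pre_scaleB !bc_pre_scaleU mulrDr; apply: TensorRelDr.
- by rewrite !bc_pre_scaleB !bc_pre_scaleU mulrCA; apply: TensorRelZ.
Qed.

Fact pi_tensorP (x y : FG) :
  reflect (\pi_(Quotient.quot tensor_relb) x = \pi_(Quotient.quot tensor_relb) y)
          (tensor_relb (x - y)).
Proof.
have -> : tensor_relb (x - y) = (x == y %[mod Quotient.quot tensor_relb]).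
  by rewrite -Quotient.idealrBE.
exact: eqP.
Qed.

Fact bc_scale_pi c x :
  bc_scale c (\pi_(Quotient.quot tensor_relb) x) =
  \pi_(Quotient.quot tensor_relb) (bc_pre_scale c x).
Proof.
apply/pi_tensorP; rewrite -bc_pre_scaleB; apply/asboolP/bc_pre_scale_rel.
by apply/asboolP/pi_tensorP; rewrite reprK.
Qed.

Fact bc_scale_tensor c m b : bc_scale c (tensor m b) = tensor m (c * b).
Proof. by rewrite bc_scale_pi bc_pre_scaleU. Qed.

Fact tensorDl m m' b : tensor (m + m') b = tensor m b + tensor m' b.
Proof.
rewrite /tensor -[RHS]raddfD; apply/pi_tensorP/asboolP.
by rewrite opprD addrA; apply: TensorRelDl.
Qed.

Fact tensorDr m b b' : tensor m (b + b') = tensor m b + tensor m b'.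
Proof.
rewrite /tensor -[RHS]raddfD; apply/pi_tensorP/asboolP.
by rewrite opprD addrA; apply: TensorRelDr.
Qed.

Fact tensorZl a m b : tensor (a *: m) b = tensor m (phi a * b).
Proof. by apply/pi_tensorP/asboolP/TensorRelZ. Qed.

Fact bc_scaleDr : right_distributive bc_scale +%R.
Proof.
move=> c x y.
rewrite -[x](@reprK _ (Quotient.quot tensor_relb)).
rewrite -[y](@reprK _ (Quotient.quot tensor_relb)).
rewrite -raddfD !bc_scale_pi -raddfD; congr (\pi_(_) _).
exact: bc_pre_scaleD.
Qed.

Fact base_change_ind (P : base_change -> Prop) :
  P 0 -> (forall m b x, P x -> P (tensor m b + x)) -> forall x, P x.
Proof.
move=> P0 PD x; rewrite -[x](@reprK _ (Quotient.quot tensor_relb)).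
rewrite -(freeg_sumE (repr x)).
elim: (dom _) => [|[m b] s IHs]; first by rewrite big_nil raddf0.
rewrite big_cons raddfD /=; move: IHs; move: (\pi_(_) _ : base_change) => y Py.
have tensor0 b' : tensor 0 b' = 0.
  by apply: (addIr (tensor 0 b')); rewrite -tensorDl addr0 add0r.
have tensorN m' b' : - tensor m' b' = tensor (- m') b'.
  by apply: (addIr (tensor m' b')); rewrite -tensorDl !addNr tensor0.
have PDn n m' y' : P y' -> P (tensor m' b *+ n + y').
  elim: n y' => [|n IHn] y' Py'; first by rewrite mulr0n add0r.
  by rewrite mulrS -addrA; apply/PD/IHn.
have E k : << k *g (m, b) >> = << (m, b) >> *~ k :> FG.
  by rewrite freegU_mulz intz.
rewrite E; case: (coeff _ _) => n.
  by rewrite -pmulrn raddfMn; apply: PDn.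
by rewrite NegzE mulrNz -pmulrn raddfN raddfMn -mulNrn /= tensorN; apply: PDn.
Qed.

Fact bc_scale0 c : bc_scale c 0 = 0.
Proof. by apply: (addIr (bc_scale c 0)); rewrite -bc_scaleDr addr0 add0r. Qed.

Fact bc_scaleA c d x : bc_scale c (bc_scale d x) = bc_scale (c * d) x.
Proof.
elim/base_change_ind: x => [|m b x IHx]; first by rewrite !bc_scale0.
by rewrite !bc_scaleDr IHx !bc_scale_tensor mulrA.
Qed.

Fact bc_scale1 : left_id 1 bc_scale.
Proof.
elim/base_change_ind=> [|m b x IHx]; first by rewrite bc_scale0.
by rewrite bc_scaleDr IHx bc_scale_tensor mul1r.
Qed.

Fact bc_scaleDl x : {morph bc_scale^~ x : c d / c + d}.
Proof.
move=> c d; elim/base_change_ind: x => [|m b x IHx].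
  by rewrite !bc_scale0 addr0.
by rewrite !bc_scaleDr IHx !bc_scale_tensor mulrDl tensorDr addrACA.
Qed.

HB.instance Definition _ := GRing.Zmodule_isLmodule.Build B base_change
  bc_scaleA bc_scale1 bc_scaleDr bc_scaleDl.
End BaseChange.

(* The argument iota makes R an F_q-algebra, so that x |-> x ^ q is additive. *)
Section Frobenius.
Variables (F : finFieldType) (R : comNzRingType) (iota : {rmorphism F -> R}).

Definition frobq of {rmorphism F -> R} := fun x : R => x ^+ #|F|.
Local Notation frob := (frobq iota).

Fact card_pchar_nat : [pchar R].-nat #|F|.
Proof.
have [p p_pr pF] := finPcharP F.
have pR : p \in [pchar R] by apply: (rmorph_pchar iota).
rewrite (eq_pnat _ (pcharf_eq pR)) -cardsT.
exact/abelem_pgroup/fin_ring_pchar_abelem.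
Qed.

Fact frobq_zmod : zmod_morphism frob.
Proof.
move=> x y; rewrite /frobq exprDn_pchar ?exprNn_pchar //; exact: card_pchar_nat.
Qed.
Fact frobq_monoid : monoid_morphism frob.
Proof. by split=> [|x y]; rewrite /frobq ?expr1n ?exprMn. Qed.

HB.instance Definition _ := GRing.isZmodMorphism.Build R R frob frobq_zmod.
HB.instance Definition _ := GRing.isMonoidMorphism.Build R R frob frobq_monoid.
End Frobenius.

(* The twisted polynomial ring R[tau], with tau * a = s a * tau.
   p = \sum_i p`_i tau ^ i, stored as its coefficient sequence. *)
Definition twisted (R : nzRingType) (s : {rmorphism R -> R}) : Type := {poly R}.

Section Twisted.
Variables (R : nzRingType) (s : {rmorphism R -> R}).
Local Notation T := (twisted s).

HB.instance Definition _ := GRing.Zmodule.on T.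

Definition tw_const (c : R) : T := c%:P.
Definition tw_tau : T := 'X.

Definition tw_mul (p r : T) : T :=
  \poly_(i < size (p : {poly R}) + size (r : {poly R}))
    (\sum_(j < i.+1) (p : {poly R})`_j * iter j s (r : {poly R})`_(i - j)).

Fact iter_rmorph0 j : iter j s 0 = 0.
Proof. by elim: j => //= j ->; rewrite rmorph0. Qed.
Fact iter_rmorph1 j : iter j s 1 = 1.
Proof. by elim: j => //= j ->; rewrite rmorph1. Qed.
Fact iter_rmorphD j : {morph iter j s : x y / x + y}.
Proof. by elim: j => // j IHj x y /=; rewrite IHj rmorphD. Qed.
Fact iter_rmorphM j : {morph iter j s : x y / x * y}.
Proof. by elim: j => // j IHj x y /=; rewrite IHj rmorphM. Qed.
Fact iter_rmorph_sum j n (f : 'I_n -> R) (P : pred 'I_n) :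
  iter j s (\sum_(i < n | P i) f i) = \sum_(i < n | P i) iter j s (f i).
Proof. exact: (big_morph _ (@iter_rmorphD j) (@iter_rmorph0 j)). Qed.

Fact coef_tw_mul (p r : T) i :
  (tw_mul p r : {poly R})`_i =
  \sum_(j < i.+1) (p : {poly R})`_j * iter j s (r : {poly R})`_(i - j).
Proof.
rewrite coef_poly; case: ltnP => // le_pr_i; rewrite big1 // => j _.
have [le_p_j|lt_j_p] := leqP (size (p : {poly R})) j.
  by rewrite nth_default ?mul0r.
rewrite [X in iter j s X]nth_default ?iter_rmorph0 ?mulr0 //.
rewrite leq_subRL ?leq_ord //; apply: leq_trans le_pr_i.
by rewrite leq_add2r ltnW.
Qed.

Fact coef_tw_mul_rev (p r : T) i :
  (tw_mul p r : {poly R})`_i =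
  \sum_(j < i.+1) (p : {poly R})`_(i - j) * iter (i - j) s (r : {poly R})`_j.
Proof.
rewrite coef_tw_mul (reindex_inj rev_ord_inj) /=.
by apply: eq_bigr => j _; rewrite (sub_ordK j).
Qed.

Fact tw_mulA : associative tw_mul.
Proof.
move=> p q r; apply/polyP=> i; rewrite coef_tw_mul coef_tw_mul_rev.
pose P := p : {poly R}; pose Q := q : {poly R}; pose U := r : {poly R}.
pose coef3 j k := P`_j * (iter j s Q`_(i - j - k) * iter (i - k) s U`_k).
transitivity (\sum_(j < i.+1) \sum_(k < i.+1 | (k <= i - j)%N) coef3 j k).
  apply: eq_bigr => /= j _; rewrite coef_tw_mul_rev iter_rmorph_sum.
  rewrite big_distrr /= (big_ord_narrow_leq (leq_subr _ _)).
  apply: eq_bigr => k _ /=; rewrite /coef3 iter_rmorphM -iterD.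
  congr (_ * (_ * iter _ _ _)).
  by rewrite addnBA ?leq_ord // subnKC ?leq_ord.
rewrite (exchange_big_dep predT) //=; apply: eq_bigr => k _.
transitivity (\sum_(j < i.+1 | (j <= i - k)%N) coef3 j k).
  apply: eq_bigl => j; rewrite -ltnS -(ltnS j) -!subSn ?leq_ord //.
  by rewrite -subn_gt0 -(subn_gt0 j) -!subnDA addnC.
rewrite (big_ord_narrow_leq (leq_subr _ _)) coef_tw_mul big_distrl /=.
by apply: eq_bigr => j _; rewrite /coef3 -!subnDA addnC mulrA.
Qed.

Fact tw_mul1l : left_id (tw_const 1) tw_mul.
Proof.
move=> p; apply/polyP => i; rewrite coef_tw_mul big_ord_recl subn0 coefC.
by rewrite mul1r big1 ?addr0 // => j _; rewrite coefC mul0r.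
Qed.

Fact tw_mul1r : right_id (tw_const 1) tw_mul.
Proof.
move=> p; apply/polyP => i; rewrite coef_tw_mul_rev big_ord_recl subn0 coefC.
rewrite iter_rmorph1 mulr1 big1 ?addr0 // => j _.
by rewrite coefC iter_rmorph0 mulr0.
Qed.

Fact tw_mulDl : left_distributive tw_mul +%R.
Proof.
move=> p q r; apply/polyP=> i; rewrite coefD !coef_tw_mul -big_split.
by apply: eq_bigr => j _; rewrite coefD mulrDl.
Qed.

Fact tw_mulDr : right_distributive tw_mul +%R.
Proof.
move=> p q r; apply/polyP=> i; rewrite coefD !coef_tw_mul -big_split.
by apply: eq_bigr => j _; rewrite coefD iter_rmorphD mulrDr.
Qed.

Fact tw_oner_neq0 : tw_const 1 != 0.
Proof. exact: (oner_neq0 {poly R}). Qed.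

HB.instance Definition _ := GRing.Zmodule_isNzRing.Build T
  tw_mulA tw_mul1l tw_mul1r tw_mulDl tw_mulDr tw_oner_neq0.

Fact tw_tauC (c : R) : tw_tau * tw_const c = tw_const (s c) * tw_tau.
Proof.
apply/polyP => i; rewrite !coef_tw_mul /tw_tau /tw_const.
case: i => [|i]; first by rewrite !big_ord1 /= !coefX /= mul0r mulr0.
rewrite (bigD1 (fintype.lift ord0 ord0)) //= [in RHS]big_ord_recl /=.
rewrite !coefX !coefC /= mul1r subn1 subn0 /=.
rewrite !big1 ?addr0 => [|j _|[[|[|j]] lt_j] //= _]; last 3 first.
- by rewrite coefC mul0r.
- by rewrite coefX mul0r.
- by rewrite coefX mul0r.
by case: i => [|i]; rewrite /= ?mulr1 ?rmorph0 ?mulr0.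
Qed.
End Twisted.

(* tau acts on an extension L of K by x |-> x ^ q. *)
Section TwistedAction.
Variables (F : finFieldType) (K : fieldType) (iota : {rmorphism F -> K}).
Variables (L : fieldExtType K).
Local Notation T := (twisted (frobq iota)).

Definition tw_act (p : T) (x : L) : L :=
  \sum_(i < size (p : {poly K})) (p : {poly K})`_i *: x ^+ (#|F| ^ i).

Definition tw_actmx (m n : nat) (A : 'M[T]_(m, n)) (x : 'cV[L]_n) : 'cV[L]_m :=
  \col_i \sum_(j < n) tw_act (A i j) (x j 0).

Fact tw_act_widen (p : T) (x : L) N : (size (p : {poly K}) <= N)%N ->
  tw_act p x = \sum_(i < N) (p : {poly K})`_i *: x ^+ (#|F| ^ i).
Proof.
move=> le_pN; rewrite /tw_act.
rewrite (big_ord_widen _ (fun i => (p : {poly K})`_i *: x ^+ (#|F| ^ i)) le_pN).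
rewrite big_mkcond /=; apply: eq_bigr => i _; case: ltnP => // le_pi.
by rewrite nth_default ?scale0r.
Qed.

Fact tw_actDl (p r : T) x : tw_act (p + r) x = tw_act p x + tw_act r x.
Proof.
pose N := maxn (size (p : {poly K})) (size (r : {poly K})).
rewrite !(@tw_act_widen _ _ N) ?leq_maxl ?leq_maxr ?size_polyD //.
by rewrite -big_split; apply: eq_bigr => i _; rewrite coefD scalerDl.
Qed.

Fact frobL_D (x y : L) i :
  (x + y) ^+ (#|F| ^ i) = x ^+ (#|F| ^ i) + y ^+ (#|F| ^ i).
Proof.
rewrite exprDn_pchar // pnatX.
by rewrite (card_pchar_nat (in_alg L \o iota : {rmorphism F -> L})).
Qed.

Fact frobL_0 i : 0 ^+ (#|F| ^ i) = 0 :> L.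
Proof. by apply: (addIr (0 ^+ (#|F| ^ i))); rewrite -frobL_D !add0r. Qed.

Fact tw_actDr (p : T) x y : tw_act p (x + y) = tw_act p x + tw_act p y.
Proof.
by rewrite -big_split; apply: eq_bigr => i _; rewrite frobL_D scalerDr.
Qed.

Fact tw_act0r (p : T) : tw_act p 0 = 0.
Proof. by rewrite /tw_act big1 // => i _; rewrite frobL_0 scaler0. Qed.

Fact tw_act0l x : tw_act 0 x = 0.
Proof. by apply: (addIr (tw_act 0 x)); rewrite -tw_actDl !add0r. Qed.

Fact tw_act_const (c : K) x : tw_act (tw_const _ c) x = c *: x.
Proof.
by rewrite (@tw_act_widen _ _ 1) ?size_polyC_leq1 // big_ord1 coefC expn0 expr1.
Qed.

Fact tw_act1 x : tw_act 1 x = x.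
Proof. by rewrite (tw_act_const 1) scale1r. Qed.

Fact coef_tw_constM (c : K) (p : T) i :
  (tw_const _ c * p : {poly K})`_i = c * (p : {poly K})`_i.
Proof.
rewrite coef_tw_mul big_ord_recl /= subn0 coefC big1 ?addr0 // => j _.
by rewrite coefC mul0r.
Qed.

Fact coef_tw_tauM (p : T) i :
  (tw_tau _ * p : {poly K})`_i =
  if i is i'.+1 then (p : {poly K})`_i' ^+ #|F| else 0.
Proof.
rewrite coef_tw_mul /tw_tau; case: i => [|i].
  by rewrite big_ord1 coefX mul0r.
rewrite (bigD1 (fintype.lift ord0 ord0)) //= coefX mul1r subn1 big1 ?addr0 //.
by move=> [[|[|j]] lt_j] //= _; rewrite coefX mul0r.
Qed.

Fact coef_tw_Mtau (p : T) i :
  (p * tw_tau _ : {poly K})`_i = if i is i'.+1 then (p : {poly K})`_i' else 0.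
Proof.
rewrite coef_tw_mul_rev /tw_tau; case: i => [|i].
  by rewrite big_ord1 coefX iter_rmorph0 ?rmorph0 mulr0.
rewrite (bigD1 (fintype.lift ord0 ord0)) //= coefX iter_rmorph1 mulr1 subn1.
rewrite big1 ?addr0 //.
by move=> [[|[|j]] lt_j] //= _; rewrite coefX iter_rmorph0 ?rmorph0 mulr0.
Qed.

Fact tw_act_constM (c : K) (p : T) x :
  tw_act (tw_const _ c * p) x = c *: tw_act p x.
Proof.
rewrite (@tw_act_widen _ _ (size (p : {poly K}))).
  by rewrite scaler_sumr; apply: eq_bigr => i _; rewrite coef_tw_constM scalerA.
by apply/leq_sizeP => j le_pj; rewrite coef_tw_constM nth_default ?mulr0.
Qed.

Fact tw_act_tauM (p : T) x : tw_act (tw_tau _ * p) x = tw_act p x ^+ #|F|.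
Proof.
rewrite (@tw_act_widen _ _ (size (p : {poly K})).+1); last first.
  apply/leq_sizeP => -[|j] // le_pj; rewrite coef_tw_tauM nth_default //.
  by rewrite expr0n gtn_eqF // ltnW // finNzRing_gt1.
rewrite big_ord_recl coef_tw_tauM scale0r add0r.
have frob_sum m (f : 'I_m -> L) :
    (\sum_(i < m) f i) ^+ #|F| = \sum_(i < m) f i ^+ #|F|.
  apply: (big_morph (fun y : L => y ^+ #|F|)) => [y z|].
    by have := frobL_D y z 1; rewrite expn1.
  by have := frobL_0 1; rewrite expn1.
rewrite frob_sum; apply: eq_bigr => i _.
by rewrite lift0 coef_tw_tauM exprZn -exprM expnSr.
Qed.

Fact tw_act_tau x : tw_act (tw_tau _) x = x ^+ #|F|.
Proof.
rewrite (@tw_act_widen _ _ 2) ?size_polyX // big_ord_recl big_ord1 !coefX /=.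
by rewrite scale0r add0r scale1r expn1.
Qed.

Fact tw_actM (p r : T) x : tw_act (p * r) x = tw_act p (tw_act r x).
Proof.
elim/(@poly_ind K): p r x => [|p c IHp] r x.
  by rewrite [_ * _](mul0r r) !tw_act0l.
have -> : p * 'X + c%:P = (p : T) * tw_tau _ + tw_const _ c :> T.
  apply/polyP => i; rewrite !coefD coef_tw_Mtau coefMX.
  by case: i.
rewrite mulrDl !tw_actDl -mulrA !IHp tw_act_tauM tw_act_constM tw_act_const.
by rewrite tw_act_tau.
Qed.

Fact tw_actmxDl m n (A B : 'M[T]_(m, n)) x :
  tw_actmx (A + B) x = tw_actmx A x + tw_actmx B x.
Proof.
apply/colP => i; rewrite !mxE -big_split; apply: eq_bigr => j _.
by rewrite mxE tw_actDl.
Qed.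

Fact tw_actmxDr m n (A : 'M[T]_(m, n)) x y :
  tw_actmx A (x + y) = tw_actmx A x + tw_actmx A y.
Proof.
apply/colP => i; rewrite !mxE -big_split; apply: eq_bigr => j _.
by rewrite mxE tw_actDr.
Qed.

Fact tw_actmxM m n o (A : 'M[T]_(m, n)) (B : 'M[T]_(n, o)) x :
  tw_actmx (A *m B) x = tw_actmx A (tw_actmx B x).
Proof.
apply/colP => i; rewrite !mxE.
transitivity (\sum_(j < o) \sum_(k < n) tw_act (A i k) (tw_act (B k j) (x j 0))).
  apply: eq_bigr => j _; rewrite mxE.
  rewrite (big_morph (tw_act^~ _) (fun p r => tw_actDl p r _) (tw_act0l _)).
  by apply: eq_bigr => k _; rewrite tw_actM.
rewrite exchange_big; apply: eq_bigr => k _; rewrite mxE.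
by rewrite (big_morph (tw_act _) (tw_actDr _) (tw_act0r _)).
Qed.

Fact tw_actmx1 n (x : 'cV[L]_n) : tw_actmx 1%:M x = x.
Proof.
apply/colP => i; rewrite !mxE (bigD1 i) //= mxE eqxx mulr1n tw_act1 big1 ?addr0 //.
by move=> j /negbTE j_i; rewrite mxE eq_sym j_i mulr0n tw_act0l.
Qed.
End TwistedAction.

(* K is any field containing F_q with a distinguished element th; the Carlitz
   module is the case K = F_q(theta), th = theta. *)
Section Carlitz.
Variables (F : finFieldType) (K : fieldType) (iota : {rmorphism F -> K}).
Variables (th : K) (n : nat).

Local Notation ktau := (twisted (frobq iota)).

Definition kC (c : K) : ktau := tw_const _ c.

(* [t]_n = theta I_n + N + tau E_{n,1} *)
Definition carlitz_t : 'M[ktau]_n :=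
  (kC th)%:M
  + \matrix_(i, j) (j == i.+1 :> nat)%:R
  + \matrix_(i, j) (if (i.+1 == n) && (j == 0%N :> nat) then tw_tau _ else 0).

(* [a]_n, the value at a of the F_q-algebra morphism sending t to [t]_n. *)
Definition carlitz (a : {poly F}) : 'M[ktau]_n :=
  \sum_(i < size a) kC (iota a`_i) *: carlitz_t ^+ i.

Fact kC_D : {morph kC : c d / c + d}.
Proof. by move=> c d; apply: polyCD. Qed.
Fact kC_0 : kC 0 = 0.
Proof. exact: polyC0. Qed.
Fact kC_M : {morph kC : c d / c * d}.
Proof.
move=> c d; apply/polyP => i; rewrite coef_tw_constM !coefC.
by case: (i == _); rewrite ?mulr0.
Qed.

Fact kC_comm (c : F) (p : ktau) : p * kC (iota c) = kC (iota c) * p.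
Proof.
have frobc j : iter j (frobq (iota)) (iota c) = iota c.
  by elim: j => //= j ->; rewrite /frobq -rmorphXn expf_card.
apply/polyP => i; rewrite coef_tw_constM coef_tw_mul_rev big_ord_recl subn0.
rewrite coefC frobc mulrC big1 ?addr0 // => j _.
by rewrite coefC iter_rmorph0 mulr0.
Qed.

Fact carlitz_widen (a : {poly F}) N : (size a <= N)%N ->
  carlitz a = \sum_(i < N) kC (iota a`_i) *: carlitz_t ^+ i.
Proof.
move=> le_aN; rewrite /carlitz.
rewrite (big_ord_widen _ (fun i => kC (iota a`_i) *: carlitz_t ^+ i) le_aN).
rewrite big_mkcond /=; apply: eq_bigr => i _; case: ltnP => // le_ai.
by rewrite nth_default // rmorph0 kC_0 scale0r.
Qed.

Fact carlitzD : {morph carlitz : a b / a + b}.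
Proof.
move=> a b; pose N := maxn (size a) (size b).
rewrite !(@carlitz_widen _ N) ?leq_maxl ?leq_maxr ?size_polyD //.
rewrite -big_split; apply: eq_bigr => i _.
by rewrite coefD rmorphD kC_D scalerDl.
Qed.

Fact carlitz0 : carlitz 0 = 0.
Proof. by rewrite /carlitz size_poly0 big_ord0. Qed.

Fact carlitzC (c : F) : carlitz c%:P = kC (iota c) *: 1%:M.
Proof.
by rewrite (@carlitz_widen _ 1) ?size_polyC_leq1 // big_ord1 coefC expr0.
Qed.

Fact carlitzX : carlitz 'X = carlitz_t.
Proof.
rewrite /carlitz size_polyX big_ord_recl big_ord1 !coefX /= rmorph0 kC_0.
by rewrite scale0r add0r rmorph1 expr1 [kC 1 *: _](scale1r carlitz_t).
Qed.

Fact carlitzZ (c : F) a : carlitz (c *: a) = kC (iota c) *: carlitz a.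
Proof.
rewrite (@carlitz_widen _ (size a)) ?size_scale_leq // scaler_sumr.
by apply: eq_bigr => i _; rewrite coefZ rmorphM kC_M scalerA.
Qed.

Fact carlitzMX a : carlitz (a * 'X) = carlitz a *m carlitz_t.
Proof.
rewrite (@carlitz_widen _ (size a).+1); last first.
  by rewrite (leq_trans (size_polyMleq _ _)) // size_polyX addn2.
rewrite big_ord_recl coefMX /= rmorph0 kC_0 scale0r add0r /carlitz mulmx_suml.
apply: eq_bigr => i _; rewrite /bump add1n coefMX /= -scalemxAl; congr (_ *: _).
exact: exprSr.
Qed.

Fact carlitz_tC a : carlitz_t *m carlitz a = carlitz a *m carlitz_t.
Proof.
rewrite /carlitz mulmx_suml mulmx_sumr; apply: eq_bigr => i _.
have TC : carlitz_t ^+ i *m carlitz_t = carlitz_t *m carlitz_t ^+ i.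
  by rewrite -[LHS]exprSr -[RHS]exprS.
rewrite -scalemxAl TC {TC}; move: (carlitz_t ^+ i) carlitz_t => A B.
apply/matrixP => u v; rewrite !mxE big_distrr /=.
by apply: eq_bigr => w _; rewrite mxE !mulrA kC_comm.
Qed.

Fact carlitzM : {morph carlitz : a b / a * b >-> a *m b}.
Proof.
move=> a b; elim/poly_ind: a b => [|a c IHa] b.
  by rewrite mul0r carlitz0 mul0mx.
rewrite mulrDl -mulrA [_ * b]mulrC carlitzD IHa carlitzD carlitzMX mulmxDl.
rewrite carlitzMX -carlitz_tC mulmxA mul_polyC carlitzZ carlitzC.
by rewrite -scalemxAl mul1mx.
Qed.

Fact carlitz1 : carlitz 1 = 1%:M.
Proof. by rewrite -[1](polyC1 F) carlitzC rmorph1 [_ *: _]scale1r. Qed.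
End Carlitz.

(* An alias of 'cV[L]_n, to carry the F_q[t]-module structure a . P = [a]_n P
   instead of the L-linear one. *)
Definition carlitz_pts (F : finFieldType) (K : fieldType)
  (iota : {rmorphism F -> K}) (th : K) (n : nat) (L : fieldExtType K) : Type :=
  'cV[L]_n.

Section CarlitzModule.
Variables (F : finFieldType) (K : fieldType) (iota : {rmorphism F -> K}).
Variables (th : K) (n : nat) (L : fieldExtType K).
Local Notation C := (carlitz_pts iota th n L).

HB.instance Definition _ := GRing.Zmodule.on C.

Definition carlitz_scale (a : {poly F}) (P : C) : C :=
  tw_actmx (carlitz iota th n a) (P : 'cV[L]_n).

Fact carlitz_scaleA a b P :
  carlitz_scale a (carlitz_scale b P) = carlitz_scale (a * b) P.
Proof. by rewrite /carlitz_scale carlitzM tw_actmxM. Qed.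
Fact carlitz_scale1 : left_id 1 carlitz_scale.
Proof. by move=> P; rewrite /carlitz_scale carlitz1 tw_actmx1. Qed.
Fact carlitz_scaleDr : right_distributive carlitz_scale +%R.
Proof. by move=> a P Q; apply: tw_actmxDr. Qed.
Fact carlitz_scaleDl P : {morph carlitz_scale^~ P : a b / a + b}.
Proof. by move=> a b; rewrite /carlitz_scale carlitzD tw_actmxDl. Qed.

HB.instance Definition _ := GRing.Zmodule_isLmodule.Build {poly F} C
  carlitz_scaleA carlitz_scale1 carlitz_scaleDr carlitz_scaleDl.
End CarlitzModule.

(* A place is represented by its normalized discrete valuation. *)
Record place (K : fieldType) := Place {
  place_ord :> K -> \bar int;
  place_ord0 : place_ord 0 = +oo%E;
  place_ord_fin : forall x, x != 0 -> exists m : int, place_ord x = m%:E%E;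
  place_ordM : forall x y, place_ord (x * y) = (place_ord x + place_ord y)%E;
  place_ordD : forall x y,
    (Order.min (place_ord x) (place_ord y) <= place_ord (x + y)%R)%E;
  place_ord_norm : exists x, place_ord x = 1%:E%E
}.

Definition lies_above (K : fieldType) (L : fieldExtType K)
    (w : place L) (v : place K) : Prop :=
  exists2 e : nat, (0 < e)%N & forall x : K, w x%:A = (v x *+ e)%E.

(* ord_w of a polynomial: the minimum over its coefficients (+oo for 0). *)
Definition poly_ord (K : fieldType) (w : place K) (f : {poly K}) : \bar int :=
  \big[Order.min/+oo%E]_(i < size f) w f`_i.

(* F_q(theta), and also F_q(t): the variable is anonymous. *)
Notation ratfun F := {fraction {poly F}}.

Section RationalFunctions.
Variable F : finFieldType.
Local Notation k := (ratfun F).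
Local Notation "p %:F" := (@FracField.tofrac {poly F} p).

Definition theta : k := 'X%:F.

Definition kconst : {rmorphism F -> k} := (@FracField.tofrac {poly F} \o polyC).

(* The infinite place of k: ord (f / g) = deg g - deg f. *)
Definition ord_infty (x : k) : \bar int :=
  if x == 0 then +oo%E
  else ((size \d_(repr x))%:Z - (size \n_(repr x))%:Z)%:E%E.

Fact frac_numden (x : k) : x = (\n_(repr x))%:F / (\d_(repr x))%:F.
Proof.
have d0 := denom_ratioP (repr x).
have dF0 : (\d_(repr x))%:F != 0 by rewrite tofrac_eq0.
apply: (canRL (mulfK dF0)); rewrite -{1}[x]reprK; move: (repr x) d0 => r d0.
unlock FracField.tofrac; rewrite -[LHS]FracField.pi_mul.
apply/eqmodP; rewrite /= FracField.equivfE /FracField.mulf.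
by rewrite !numden_Ratio ?mulf_neq0 ?oner_neq0 // !mulr1 mulrC.
Qed.

Fact ord_inftyE (f g : {poly F}) : f != 0 -> g != 0 ->
  ord_infty (f%:F / g%:F) = ((size g)%:Z - (size f)%:Z)%:E%E.
Proof.
move=> f0 g0; pose x : k := f%:F / g%:F.
have x0 : x != 0 by rewrite mulf_neq0 ?invr_neq0 ?tofrac_eq0.
rewrite -/x /ord_infty (negbTE x0); congr (_%:E%E).
have := frac_numden x; have d0 := denom_ratioP (repr x).
move: (\n_(repr x)) (\d_(repr x)) d0 => n d d0 xE.
have n0 : n != 0.
  by apply: contra_neq x0 => n0; rewrite xE n0 rmorph0 mul0r.
have E : f * d = n * g.
  apply/eqP; rewrite -tofrac_eq !tofracM; apply/eqP.
  by move/eqP: xE; rewrite /x eqr_div ?tofrac_eq0 // => /eqP.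
have := congr1 (fun p : {poly F} => size p) E; rewrite !size_mul //.
have := size_poly_gt0 f; have := size_poly_gt0 g; have := size_poly_gt0 d.
have := size_poly_gt0 n; rewrite f0 g0 n0 d0.
by move: (size f) (size g) (size n) (size d) => *; lia.
Qed.

Fact fracP (x : k) : x != 0 ->
  exists f g : {poly F}, [/\ f != 0, g != 0 & x = f%:F / g%:F].
Proof.
move=> x0; exists \n_(repr x), \d_(repr x); split; last exact: frac_numden.
  by apply: contra_neq x0 => n0; rewrite (frac_numden x) n0 rmorph0 mul0r.
exact: denom_ratioP.
Qed.

Fact ord_infty0 : ord_infty 0 = +oo%E.
Proof. by rewrite /ord_infty eqxx. Qed.

Fact ord_infty_fin x : x != 0 -> exists m : int, ord_infty x = m%:E%E.
Proof. by move=> /negbTE x0; rewrite /ord_infty x0; eexists. Qed.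

Fact ord_inftyM x y : ord_infty (x * y) = (ord_infty x + ord_infty y)%E.
Proof.
have [->|x0] := eqVneq x 0.
  rewrite mul0r ord_infty0; have [->|/ord_infty_fin[m ->]//] := eqVneq y 0.
  by rewrite ord_infty0.
have [->|y0] := eqVneq y 0.
  by rewrite mulr0 ord_infty0; have [m ->] := ord_infty_fin x0.
have [f [g [f0 g0 ->]]] := fracP x0; have [h [l [h0 l0 ->]]] := fracP y0.
rewrite mulf_div -!tofracM !ord_inftyE ?mulf_neq0 // -EFinD; congr (_%:E%E).
rewrite !size_mul //.
have := size_poly_gt0 f; have := size_poly_gt0 g; have := size_poly_gt0 h.
have := size_poly_gt0 l; rewrite f0 g0 h0 l0.
by move: (size f) (size g) (size h) (size l) => *; lia.
Qed.

Fact ord_inftyD x y :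
  (Order.min (ord_infty x) (ord_infty y) <= ord_infty (x + y)%R)%E.
Proof.
have [->|x0] := eqVneq x 0; first by rewrite add0r ge_min lexx orbT.
have [->|y0] := eqVneq y 0; first by rewrite addr0 ge_min lexx.
have [xy0|] := eqVneq (x + y) 0; first by rewrite xy0 ord_infty0 leey.
have [f [g [f0 g0 ->]]] := fracP x0; have [h [l [h0 l0 ->]]] := fracP y0.
have gF0 : g%:F != 0 by rewrite tofrac_eq0.
have lF0 : l%:F != 0 by rewrite tofrac_eq0.
have -> : f%:F / g%:F + h%:F / l%:F = (f * l + h * g)%:F / (g * l)%:F.
  by rewrite tofracD !tofracM; apply: (@addf_div k _ _ _ _ gF0 lF0).
move=> s0.
have n0 : f * l + h * g != 0.
  by apply: contra_neq s0 => ->; rewrite rmorph0 mul0r.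
rewrite !ord_inftyE ?mulf_neq0 // ge_min !lee_fin.
have := size_polyD (f * l) (h * g).
have := size_poly_gt0 f; have := size_poly_gt0 g; have := size_poly_gt0 h.
have := size_poly_gt0 l; rewrite !size_mul // f0 g0 h0 l0.
move: (size (f * l + h * g)) (size f) (size g) (size h) (size l) => *; lia.
Qed.

Fact ord_infty_norm : exists x, ord_infty x = 1%:E%E.
Proof.
exists (1%:F / 'X%:F).
by rewrite ord_inftyE ?oner_neq0 ?polyX_eq0 // size_polyX size_poly1.
Qed.

Definition infinite_place : place k :=
  Place ord_infty0 ord_infty_fin ord_inftyM ord_inftyD ord_infty_norm.

Variable L : fieldExtType k.

Definition divides_infty (w : place L) : Prop := lies_above w infinite_place.

Definition Lconst : {rmorphism F -> L} := (in_alg L \o kconst).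

Definition thetaL : L := theta%:A.

Definition carlitz_tensor (n : nat) : lmodType {poly F} :=
  carlitz_pts kconst theta n L.

(* L[t] as an F_q[t]-module *)
Definition Lt_module : lmodType {poly F} :=
  restrict_scalars (map_poly Lconst).

(* For P = (p_(n-1), ..., p_0)^tr, the polynomial
   p_0 + p_1 (t - theta) + ... + p_(n-1) (t - theta)^(n-1) of L[t]. *)
Definition poly_of_point (n : nat) (P : carlitz_tensor n) : {poly L} :=
  \sum_(j < n) (P : 'cV[L]_n) (rev_ord j) 0 *: ('X - thetaL%:P) ^+ j.
End RationalFunctions.

(* Main.v *)
(* Reducing L[t] modulo the relations (t - theta)^n g = tau g identifies
   C^{(x) n}(L) with the cokernel of (t - theta)^n - tau on L[t], P_i being the
   class of f_i. A relation sum a_i P_i = 0 thus reads f = (t - theta)^n g - tau g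
   with f = sum a_i f_i. At a finite place tau multiplies the order of a pole of
   g by q, so a pole of g would give f a pole of order at least q; hence g is
   integral there. The leading coefficient of g is one of f, hence vanishes at
   the infinite places; being regular everywhere it is 0, so g = 0, f = 0 and
   all a_i = 0. The places needed for the last step are built from maximal
   subrings avoiding a given element.
   For the dimension, no ramification hypothesis is needed: if u is a
   uniformizer at a finite place, the points with f_j = u^-(qj+1) are
   independent, because the order of a pole of (t - theta)^n g - tau g is
   divisible by q. *)
Require Import Defs.
From HB Require Import structures.
From mathcomp Require Import all_boot all_order all_algebra all_field.
From mathcomp Require Import boolp constructive_ereal.
From mathcomp Require classical_sets.
From mathcomp Require Import zify ring.
From mathcomp.multinomials Require Import freeg.

Set Implicit Arguments.
Unset Strict Implicit.
Unset Printing Implicit Defensive.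
Import Order.TTheory GRing.Theory Num.Theory.
Local Open Scope ring_scope.

(** * Valuation rings from maximal subrings *)

Lemma maximal_subring_avoiding (L : fieldType) (A : subringClosed L) (x : L) :
  x \notin A ->
  exists B : subringClosed L, [/\ {subset A <= B}, x \notin B &
    forall C : subringClosed L, {subset B <= C} -> x \notin C ->
      {subset C <= B}].
Proof.
move=> xA.
(* Zorn's lemma runs over sets [X] to be joined to [A], so that the empty chain yields [A]
   itself. *)
pose ext (X : L -> Prop) : {pred L} := fun z => `[< z \in A \/ X z >].
have subext X : {subset A <= ext X} by move=> z zA; apply/asboolP; left.
pose P X := subring_closed (ext X) /\ x \notin ext X.
have [G GP Gtot|X [[Xring xX] Xmax]] := @classical_sets.Zorn_bigcup L P.
  set U := classical_sets.bigcup _ _.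
  have extU z : reflect (z \in A \/ exists2 X, G X & z \in ext X) (z \in ext U).
    apply: (iffP (asboolP _)) => -[zA|[X GX Xz]]; [by left| |by left|].
      by right; exists X => //; apply/asboolP; right.
    by move/asboolP: Xz => [zA|Xz]; [left|right; exists X].
  have pairU z y : z \in ext U -> y \in ext U ->
      (z \in A) && (y \in A) \/ exists2 X, G X & (z \in ext X) && (y \in ext X).
    have mono X Y : classical_sets.subset X Y -> {subset ext X <= ext Y}.
      by move=> XY u /asboolP[uA|/XY Yu]; apply/asboolP; [left|right].
    move=> /extU[zA|[X GX zX]] /extU[yA|[Y GY yY]]; first by left; rewrite zA.
    - by right; exists Y => //; rewrite yY subext.
    - by right; exists X => //; rewrite zX subext.
    - right; have [/mono XY|/mono YX] := Gtot _ _ GX GY.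
        by exists Y => //; rewrite yY XY.
      by exists X => //; rewrite zX YX.
  split; last first.
    apply/negP => /extU[xA'|[X GX xX]]; first by rewrite xA' in xA.
    by have [_ /negP] := GP X GX; apply.
  split=> [|z y zU yU|z y zU yU]; first by apply: subext; apply: rpred1.
    have [/andP[zA yA]|[X GX /andP[zX yX]]] := pairU z y zU yU.
      by apply: subext; apply: rpredB.
    by apply/extU; right; exists X => //; have [[_ XB _] _] := GP X GX; apply: XB.
  have [/andP[zA yA]|[X GX /andP[zX yX]]] := pairU z y zU yU.
    by apply: subext; apply: rpredM.
  by apply/extU; right; exists X => //; have [[_ _ XM] _] := GP X GX; apply: XM.
pose B : subringClosed L :=
  HB.pack (ext X) (GRing.isSubringClosed.Build L (ext X) Xring).
exists B; split => // [|C BC xC z zC]; first exact: subext.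
apply: contrapT => /negP zB.
have extC : ext (fun u => u \in C) =i C.
  move=> u; apply/asboolP/idP; last by right.
  by case=> // uA; apply: BC; apply: subext.
apply: (Xmax (fun u => u \in C)).
  split=> [u Xu|sub]; first by apply: BC; apply/asboolP; right.
  by move/negP: zB; apply; apply/asboolP; right; apply: sub.
split; last by rewrite extC.
split=> [|u v|u v]; rewrite !extC; [exact: rpred1|exact: rpredB|exact: rpredM].
Qed.

Lemma adjoin_subring (L : fieldType) (B : subringClosed L) (z : L) :
  exists C : subringClosed L, forall y,
    y \in C <-> exists2 p : {poly L}, p \is a polyOver B & y = p.[z].
Proof.
pose C : {pred L} :=
  fun y => `[< exists2 p : {poly L}, p \is a polyOver B & y = p.[z] >].
have CP y : reflect (exists2 p : {poly L}, p \is a polyOver B & y = p.[z])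
  (y \in C) by exact: asboolP.
have Cring : subring_closed C.
  split=> [|_ _ /CP[p pB ->] /CP[r rB ->]|_ _ /CP[p pB ->] /CP[r rB ->]].
  - by apply/CP; exists 1; rewrite ?rpred1 ?hornerC.
  - by apply/CP; exists (p - r); rewrite ?rpredB ?hornerD ?hornerN.
  - by apply/CP; exists (p * r); rewrite ?rpredM ?hornerM.
exists (HB.pack C (GRing.isSubringClosed.Build L C Cring) : subringClosed L).
by move=> y; split=> /CP.
Qed.

(** If [z] and [z^-1] were both outside a maximal subring [B] avoiding [x], then [x] would be a
    polynomial over [B] in each of them, and the longer of the two expressions could be shortened by
    the other without end, as in Chevalley's extension theorem. *)
Lemma valuation_ring_avoiding (L : fieldType) (A : subringClosed L) (x : L) :
  x \notin A -> x^-1 \in A ->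
  exists V : subringClosed L, [/\ {subset A <= V}, x \notin V &
    forall z, (z \in V) || (z^-1 \in V)].
Proof.
move=> xA yA; have [B [AB xB Bmax]] := maximal_subring_avoiding xA.
exists B; split=> // z0.
have x0 : x != 0 by apply: contraNneq xB => ->; apply: rpred0.
have yB : x^-1 \in B by apply: AB.
have xadj z : z \notin B -> exists2 p : {poly L}, p \is a polyOver B & x = p.[z].
  move=> zB; have [C CP] := adjoin_subring B z.
  apply/CP; apply: contraNT zB => /(Bmax C); apply => [b bB|].
    by apply/CP; exists b%:P; rewrite ?polyOverC ?hornerC.
  by apply/CP; exists 'X; rewrite ?polyOverX ?hornerX.
(* x^-1 lies in the Jacobson radical of B. *)
have unitB b : b \in B ->
    (1 - x^-1 * b != 0) && ((1 - x^-1 * b)^-1 \in B).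
  move=> bB; set u := 1 - _; have uB : u \in B by rewrite rpredB ?rpred1 ?rpredM.
  have xu : x * (1 - u) = b by rewrite /u opprB addrC subrK mulVKf.
  have u0 : u != 0.
    by apply: contraNneq xB => u0; rewrite -[x]mulr1 -[1]subr0 -u0 xu.
  rewrite u0; apply: contraNT xB => /xadj[p pB xE].
  (* From [x = p.[u^-1]], the product [x * u ^+ size p] is in [B]. So is [x * (1 - u ^+ d)] for
     every [d], because [1 - u] divides [1 - u ^+ d] and [x * (1 - u) = b]. For [d = size p] the two
     add up to [x]. *)
  have xuB d : x * (1 - u ^+ d) \in B.
    elim: d => [|d IHd]; first by rewrite subrr mulr0 rpred0.
    have -> : x * (1 - u ^+ d.+1) = x * (1 - u ^+ d) + u ^+ d * b.
      by rewrite -xu exprSr; ring.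
    by apply: rpredD => //; rewrite rpredM ?rpredX.
  have -> : x = x * u ^+ size p + x * (1 - u ^+ size p).
    by rewrite -mulrDr addrC subrK mulr1.
  rewrite rpredD //; rewrite {1}xE horner_coef mulr_suml rpred_sum // => i _.
  rewrite exprVn -mulrA rpredM ?(polyOverP pB) //.
  rewrite -[X in _ * _ ^+ X](subnKC (ltnW (ltn_ord i))).
  by rewrite exprD mulKf ?expf_neq0 ?rpredX.
have no_pair m : forall (z : L) (p r : {poly L}), p \is a polyOver B ->
    r \is a polyOver B -> z != 0 -> (size p + size r <= m)%N ->
    x = p.[z] -> x = r.[z^-1] -> False.
  elim: m => [|m IHm] z p r pB rB zn0 szpr xp xr.
    have p0 : p = 0 by apply/eqP; rewrite -size_poly_eq0; lia.
    by rewrite xp p0 horner0 eqxx in x0.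
  wlog le_rp : z p r pB rB zn0 szpr xp xr / (size r <= size p)%N => [wl|].
    have /orP[le_rp|le_pr] := leq_total (size r) (size p).
      exact: (wl z p r).
    by apply: (wl z^-1 r p) => //; rewrite ?invr_eq0 ?invrK // addnC.
  have [/eqP p0|p0] := posnP (size p).
    by rewrite size_poly_eq0 in p0; rewrite xp (eqP p0) horner0 eqxx in x0.
  pose d := (size p).-1; have szp : size p = d.+1 by rewrite /d prednK.
  have /andP[] := unitB r`_0 (polyOverP rB 0); set u := 1 - _ => u0 uB.
  (* Multiplied by [z ^+ d], the equation [x = r.[z^-1]] expresses [x * u * z ^+ d] through lower
     powers of [z]. Since [u^-1] and [x^-1] are in [B], the top term of [p] can be traded for lower
     ones. *)
  have xuE : x * u * z ^+ d = \sum_(i < d) r`_(d - i) * z ^+ i.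
    have : r.[z^-1] * z ^+ d = \sum_(i < d.+1) r`_(d - i) * z ^+ i.
      rewrite (@horner_coef_wide _ d.+1) -?szp // szp mulr_suml.
      rewrite (reindex_inj rev_ord_inj) /=; apply: eq_bigr => i _.
      rewrite subSS exprVn -mulrA; congr (_ * _).
      have le_id : (i <= d)%N by rewrite -ltnS.
      by rewrite -[in z ^+ d](subnK le_id) exprD mulKf ?expf_neq0.
    rewrite -xr big_ord_recr /= subnn => E.
    apply: (addIr (r`_0 * z ^+ d)); rewrite -E /u mulrBr mulr1 mulVKf //.
    by rewrite mulrBl subrK.
  pose c := p`_d * x^-1 * u^-1.
  have cB : c \in B by rewrite !rpredM // (polyOverP pB).
  pose p' := \poly_(i < d) (p`_i + c * r`_(d - i)).
  apply: (IHm z p' r) => //.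
  - apply/polyOverP => i; rewrite coef_poly; case: ifP => _; last exact: rpred0.
    by rewrite rpredD ?rpredM ?(polyOverP pB) ?(polyOverP rB).
  - rewrite -ltnS; apply: leq_trans szpr.
    by rewrite szp addSn ltnS leq_add2r size_poly.
  rewrite horner_poly {1}xp horner_coef szp big_ord_recr /=.
  under [RHS]eq_bigr do rewrite mulrDl -mulrA.
  rewrite big_split /= -mulr_sumr -xuE; congr (_ + _).
  rewrite -/d /c; clearbody u; by field; rewrite x0 u0.
apply: contraT; rewrite negb_or => /andP[/xadj[p pB xp] /xadj[r rB xr]].
have [z00|z0n] := eqVneq z0 0.
  by move: xB; rewrite xp z00 horner_coef0 (polyOverP pB).
by case: (no_pair _ z0 p r pB rB z0n (leqnn _) xp xr).
Qed.

(** Dividing by the least positive value [d] normalizes [m]: a nonzero remainder modulo [d] would be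
    a smaller positive value. *)
Lemma place_of_valuation (L : fieldType) (m : L -> int) :
  (forall x y, x != 0 -> y != 0 -> m (x * y) = m x + m y) ->
  (forall x y, x != 0 -> y != 0 -> x + y != 0 ->
     Num.min (m x) (m y) <= m (x + y)) ->
  (exists2 x, x != 0 & m x != 0) ->
  exists (w : place L) (d : int), 0 < d /\
    forall x, x != 0 -> exists2 a : int, w x = a%:E%E & m x = a * d.
Proof.
move=> mM mD [x1 x1n mx1].
have m1 : m 1 = 0.
  by have := mM 1 1 (oner_neq0 _) (oner_neq0 _); rewrite mulr1; lia.
have mV x : x != 0 -> m x^-1 = - m x.
  by move=> x0; have := mM x x^-1 x0; rewrite invr_eq0 divff // m1 => /(_ x0); lia.
have mXn x n : x != 0 -> m (x ^+ n) = m x *+ n.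
  move=> x0; elim: n => [|n IHn]; first by rewrite m1.
  by rewrite exprS mM ?expf_neq0 // IHn mulrS.
have mXz x (a : int) : x != 0 -> m (x ^ a) = a * m x.
  move=> x0; case: a => n; first by rewrite -exprnP mXn // -mulr_natl natz.
  by rewrite NegzE -exprnN mV ?expf_neq0 // mXn // -mulr_natl natz mulNr.
pose Q (n : nat) := (0 < n)%N && `[< exists2 x, x != 0 & m x = n%:Z >].
have exQ : exists n, Q n.
  have [mx_ge0|mx_lt0] := lerP 0 (m x1).
    exists `|m x1|%N; rewrite /Q absz_gt0 mx1; apply/asboolP.
    by exists x1 => //; rewrite gez0_abs.
  exists `|m x1|%N; rewrite /Q absz_gt0 mx1; apply/asboolP.
  by exists x1^-1; rewrite ?invr_eq0 // mV // ltz0_abs.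
case: (ex_minnP exQ) => d /andP[d_gt0 /asboolP[y y0 my]] dmin.
have dvd x : x != 0 -> m x = (m x %/ d)%Z * d.
  move=> x0; have d0 : (d : int) != 0 by rewrite -lt0n.
  have r_lt := ltz_mod (m x) d0; have r_ge := modz_ge0 (m x) d0.
  have E := divz_eq (m x) d; rewrite {1}E.
  suff -> : (m x %% d)%Z = 0 by rewrite addr0.
  apply: contraTeq r_lt => rn0; rewrite -leNgt.
  have xy0 : x * y ^ (- (m x %/ d)%Z) != 0 by rewrite mulf_neq0 ?expfz_neq0.
  have mr : m (x * y ^ (- (m x %/ d)%Z)) = (m x %% d)%Z.
    by rewrite mM ?expfz_neq0 // mXz // my {1}E; lia.
  have /dmin : Q `|(m x %% d)%Z|%N.
    rewrite /Q absz_gt0 rn0; apply/asboolP; eexists; first exact: xy0.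
    by rewrite mr gez0_abs.
  by rewrite -(gez0_abs r_ge); lia.
pose v x : \bar int := if x == 0 then +oo%E else (m x %/ d)%Z%:E%E.
have vn x : x != 0 -> v x = (m x %/ d)%Z%:E%E by rewrite /v => /negbTE ->.
have dz : (0 < d :> int) by [].
have vmono a b : a != 0 -> b != 0 -> m a <= m b -> (m a %/ d)%Z <= (m b %/ d)%Z.
  by move=> /dvd {1}-> /dvd {1}->; rewrite ler_pM2r.
have v0 : v 0 = +oo%E by rewrite /v eqxx.
have vM x y' : v (x * y') = (v x + v y')%E.
  have [->|x0] := eqVneq x 0.
    by rewrite mul0r v0 /v; case: ifP.
  have [->|y'0] := eqVneq y' 0; first by rewrite mulr0 v0 vn.
  rewrite !vn ?mulf_neq0 // -EFinD; congr (_%:E%E).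
  by rewrite mM // (dvd x) // (dvd y') // -mulrDl !mulzK // gt_eqF.
have vD x y' : (Order.min (v x) (v y') <= v (x + y')%R)%E.
  have [->|x0] := eqVneq x 0; first by rewrite add0r ge_min lexx orbT.
  have [->|y'0] := eqVneq y' 0; first by rewrite addr0 ge_min lexx.
  have [->|xy0] := eqVneq (x + y') 0; first by rewrite v0 leey.
  rewrite !vn // ge_min !lee_fin.
  by have := mD _ _ x0 y'0 xy0; rewrite ge_min => /orP[]/vmono->//;
    rewrite ?orbT.
have vfin x : x != 0 -> exists a : int, v x = a%:E%E.
  by move=> x0; rewrite vn //; eexists.
have vnorm : exists x, v x = 1%:E%E.
  by exists y; rewrite vn // my divzz gt_eqF.
exists (Place v0 vfin vM vD vnorm), d; split=> // x x0.
by exists (m x %/ d)%Z; rewrite /= ?vn // -dvd.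
Qed.

(** * Units and maximal ideal of a valuation ring *)

Section ValuationRing.
Variables (L : fieldType) (V : subringClosed L).
Hypothesis Vval : forall z, (z \in V) || (z^-1 \in V).

Lemma valring_root x n : (0 < n)%N -> x ^+ n \in V -> x \in V.
Proof.
case: n => // n _ xnV; have /orP[//|yV] := Vval x.
have [->|x0] := eqVneq x 0; first exact: rpred0.
have -> : x = x ^+ n.+1 * x^-1 ^+ n.
  by rewrite exprS exprVn mulfK ?expf_neq0.
by apply: rpredM => //; apply: rpredX.
Qed.

Definition valunit : {pred L} :=
  fun z => [&& z != 0, z \in V & z^-1 \in V].

Lemma valunitM x y : x \in valunit -> y \in valunit -> x * y \in valunit.
Proof.
move=> /and3P[x0 xV xiV] /and3P[y0 yV yiV].
by apply/and3P; rewrite mulf_neq0 ?invfM ?rpredM.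
Qed.

Lemma valunitV x : (x^-1 \in valunit) = (x \in valunit).
Proof.
by apply/and3P/and3P; rewrite invr_eq0 invrK => -[].
Qed.

Lemma valunit1 : 1 \in valunit.
Proof. by apply/and3P; rewrite invr1 oner_neq0 rpred1. Qed.

Lemma valunitX x n : x \in valunit -> x ^+ n \in valunit.
Proof.
by move=> xU; elim: n => [|n IHn]; rewrite ?valunit1 // exprS valunitM.
Qed.

(** The maximal ideal. Membership in [V] need not be demanded: [z^-1] outside [V] already forces [z]
    into [V]. *)
Definition valmax : {pred L} := fun z => (z == 0) || (z^-1 \notin V).

Lemma valmaxE z : (z \in valmax) = (z \in V) && (z \notin valunit).
Proof.
rewrite -[LHS]/(_ || _) -[z \in valunit]/[&& _, _ & _].
have [->|z0] /= := eqVneq z 0; first by rewrite rpred0.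
rewrite negb_and; have := Vval z; case: (z \in V) => //=.
by move=> ->.
Qed.

Lemma valmax_sub z : z \in valmax -> z \in V.
Proof. by rewrite valmaxE => /andP[]. Qed.

Lemma valmaxM a z : a \in V -> z \in valmax -> a * z \in valmax.
Proof.
move=> aV /orP[/eqP->|zV]; apply/orP; first by left; rewrite mulr0.
have [|a0] := eqVneq a 0; first by move=> ->; rewrite mul0r; left.
right; apply: contraNN zV => azV.
by have -> : z^-1 = a * (a * z)^-1; rewrite ?rpredM // invfM mulVKf.
Qed.

Lemma valmaxD x y : x \in valmax -> y \in valmax -> x + y \in valmax.
Proof.
move=> xm ym; have [->|x0] := eqVneq x 0; first by rewrite add0r.
have [->|y0] := eqVneq y 0; first by rewrite addr0.
have /orP[xyV|yxV] := Vval (x / y).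
  have -> : x + y = (x / y + 1) * y by rewrite mulrDl mul1r divfK.
  by rewrite valmaxM ?rpredD ?rpred1.
rewrite invf_div in yxV.
have -> : x + y = (1 + y / x) * x by rewrite mulrDl mul1r divfK.
by rewrite valmaxM ?rpredD ?rpred1.
Qed.

Lemma valmax_sum (I : Type) (s : seq I) (P : pred I) (t : I -> L) :
  (forall i, P i -> t i \in valmax) -> \sum_(i <- s | P i) t i \in valmax.
Proof.
move=> tm; apply: (big_ind (fun z => z \in valmax)) => //; last exact: valmaxD.
by apply/orP; left.
Qed.

(* In a vanishing sum, the minimal valuation is attained at least twice. *)
Lemma valunit_sum0 (I : finType) (t : I -> L) :
  \sum_i t i = 0 -> (exists i, t i != 0) ->
  exists i j, [/\ i != j, t i != 0, t j != 0 & t i / t j \in valunit].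
Proof.
move=> sum0 [i0 ti0].
have [i ti imax] : exists2 i, t i != 0 & forall j, t j / t i \in V.
  have H (s : seq I) : exists2 i, t i != 0 & {in s, forall j, t j / t i \in V}.
    elim: s => [|j s [i ti IHs]]; first by exists i0.
    have [tjiV|tjiV] := boolP (t j / t i \in V).
      by exists i => // k; rewrite inE => /predU1P[->|/IHs].
    have := Vval (t j / t i); rewrite (negbTE tjiV) /= invf_div => tijV.
    have tj : t j != 0 by apply: contraNneq tjiV => ->; rewrite mul0r rpred0.
    exists j => // k; rewrite inE => /predU1P[->|/IHs tkiV].
      by rewrite divff ?rpred1.
    have -> : t k / t j = (t k / t i) * (t i / t j) by rewrite mulrA divfK.
    by rewrite rpredM.
  by have [i ti Hi] := H (enum I); exists i => // j; rewrite Hi ?mem_enum.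
apply: contrapT => no_pair.
(* Without a unit ratio, dividing by the dominant term [t i] writes [-1] as a sum of elements of the
   maximal ideal. *)
have : -1 \in valmax.
  have -> : -1 = \sum_(j | j != i) t j / t i.
    rewrite -mulr_suml; apply: (canRL (mulfK ti)).
    by apply: (addIr (t i)); move: sum0; rewrite (bigD1 i) //= addrC => ->;
      rewrite mulN1r addNr.
  apply: valmax_sum => j ji; rewrite valmaxE imax; apply/negP => U.
  apply: no_pair; exists j, i; split=> //.
  by case/and3P: U; rewrite mulf_eq0 negb_or => /andP[].
by rewrite -[_ \in _]/(_ || _) oppr_eq0 oner_eq0 invrN1 rpredN1.
Qed.
End ValuationRing.

(* Every value is an integral multiple of 1/N times the value of pi, so the value
   group is infinite cyclic. *)
Lemma place_of_discrete_valring (L : fieldType) (V : subringClosed L)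
    (pi : L) (N : nat) :
  (forall z, (z \in V) || (z^-1 \in V)) -> (0 < N)%N -> pi != 0 ->
  pi \in valmax V ->
  (forall y, y != 0 -> exists m : int, y ^+ N / pi ^ m \in valunit V) ->
  exists w : place L, forall z, (z \in V) = (0 <= w z)%E.
Proof.
move=> Vval N0 pi0 piM exm.
have pi_n n : (pi ^+ n)^-1 \in V -> n = 0%N.
  case: n => // n; rewrite -exprVn => /(valring_root Vval (ltn0Sn _)) piV.
  by case/orP: piM; rewrite ?(negbTE pi0) ?piV.
have pi_z (a : int) : (0 <= a) = (pi ^ a \in V).
  case: a => n; first by rewrite -exprnP rpredX // (valmax_sub Vval).
  by rewrite NegzE -exprnN; apply/esym/negbTE/negP => /pi_n.
have pi_u (a : int) : pi ^ a \in valunit V -> a = 0.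
  case/and3P=> _; rewrite -pi_z invr_expz -pi_z; lia.
(* [m y] is the value of [y] on the scale where [pi] has value [N]; by [pi_u] it is determined by
   [y]. *)
have [m mP] : exists m : L -> int, forall y, y != 0 ->
    y ^+ N / pi ^ (m y) \in valunit V.
  suff /choice[m mP] : forall y, exists a : int,
      y != 0 -> y ^+ N / pi ^ a \in valunit V.
    by exists m.
  move=> y; have [->|y0] := eqVneq y 0; first by exists 0.
  by have [a aP] := exm y y0; exists a.
have pz0 (a : int) : pi ^ a != 0 by rewrite expfz_neq0.
have mM x y : x != 0 -> y != 0 -> m (x * y) = m x + m y.
  move=> x0 y0; apply/eqP; rewrite eq_sym -subr_eq0; apply/eqP/pi_u.
  have -> : pi ^ (m x + m y - m (x * y)) =
      ((x * y) ^+ N / pi ^ (m (x * y))) *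
      ((x ^+ N / pi ^ (m x)) * (y ^+ N / pi ^ (m y)))^-1.
    rewrite !expfzDr // -invr_expz exprMn.
    have := pz0 (m x); have := pz0 (m y); have := pz0 (m (x * y)).
    have := expf_neq0 N x0; have := expf_neq0 N y0.
    move: (pi ^ _) (pi ^ _) (pi ^ _) (x ^+ N) (y ^+ N) => a b c d e *.
    by field; do ?[apply/andP; split].
  apply: valunitM; first by rewrite mP ?mulf_neq0.
  by rewrite valunitV; apply: valunitM; apply: mP.
have mV z : z != 0 -> (z \in V) = (0 <= m z).
  move=> z0; have /and3P[_ U Ui] := mP z z0; rewrite invf_div in Ui.
  apply/idP/idP => [zV|].
    rewrite pi_z; have -> : pi ^ m z = pi ^ m z / z ^+ N * z ^+ N.
      by rewrite divfK ?expf_neq0.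
    by rewrite rpredM // rpredX.
  rewrite pi_z => piV; apply: (valring_root Vval N0).
  by rewrite -(divfK (pz0 (m z)) (z ^+ N)) rpredM.
have mD x y : x != 0 -> y != 0 -> x + y != 0 ->
    Num.min (m x) (m y) <= m (x + y).
  wlog le_xy : x y / m x <= m y => [wl|] x0 y0 xy0.
    have /orP[le|le] := le_total (m x) (m y); first exact: wl.
    by rewrite minC addrC wl // addrC.
  rewrite ge_min; apply/orP; left.
  have ix0 : x^-1 != 0 by rewrite invr_eq0.
  have yxE : m y = m (y / x) + m x by rewrite -mM ?mulf_neq0 // divfK.
  have sxE : m (x + y) = m (1 + y / x) + m x.
    rewrite -mM // ?mulrDl ?mul1r ?divfK //.
    by apply: contra_neq xy0 => E; rewrite -[x]mul1r -[y](divfK x0) -mulrDl E mul0r.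
  have yxV : y / x \in V by rewrite mV ?mulf_neq0 //; lia.
  have E0 : 1 + y / x != 0.
    by apply: contra_neq xy0 => E; rewrite -[x]mul1r -[y](divfK x0) -mulrDl E mul0r.
  have : 1 + y / x \in V by rewrite rpredD ?rpred1.
  by rewrite mV //; lia.
have mpi : m pi = N.
  apply/eqP; rewrite eq_sym -subr_eq0; apply/eqP/pi_u.
  by rewrite expfzDr // -invr_expz -exprnP mP.
have [|w [d [d0 wP]]] := place_of_valuation mM mD.
  by exists pi; rewrite // mpi -lt0n.
exists w => z; have [->|z0] := eqVneq z 0; first by rewrite rpred0 place_ord0 leey.
by have [a -> mz] := wP z z0; rewrite mV // mz lee_fin pmulr_lge0.
Qed.

(** * Elements of [k] as quotients of polynomials in theta *)

Section RationalBase.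
Variables (F : finFieldType) (L : fieldExtType (ratfun F)).
Local Notation th := (thetaL L).

Lemma thetaL_evalE (p : {poly F}) :
  (@FracField.tofrac {poly F} p)%:A = (map_poly (Lconst L) p).[th].
Proof.
elim/poly_ind: p => [|p c IHp]; first by rewrite !rmorph0 horner0 scale0r.
rewrite rmorphD rmorphM scalerDl !rmorphD !rmorphM /= map_polyX map_polyC.
by rewrite hornerMXaddC -IHp -scalerAl mul1r scalerA.
Qed.

Lemma thetaL_eval_eq0 (p : {poly F}) :
  ((map_poly (Lconst L) p).[th] == 0) = (p == 0).
Proof. by rewrite -thetaL_evalE scaler_eq0 oner_eq0 orbF tofrac_eq0. Qed.

Lemma thetaL_neq0 : th != 0.
Proof.
by rewrite -[th]hornerX -(map_polyX (Lconst L)) thetaL_eval_eq0 polyX_eq0.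
Qed.

Lemma ratfun_evalE (c : ratfun F) : c != 0 -> exists f g : {poly F},
  [/\ f != 0, g != 0 &
   c%:A = (map_poly (Lconst L) f).[th] / (map_poly (Lconst L) g).[th]].
Proof.
move=> /fracP[f [g [f0 g0 ->]]]; exists f, g; split=> //.
have g1 := thetaL_eval_eq0 g; rewrite (negbTE g0) in g1.
apply: (canRL (mulfK (negbT g1))); rewrite -!thetaL_evalE -scalerAl mul1r scalerA.
by rewrite divfK // tofrac_eq0.
Qed.
End RationalBase.

(** * Valuation rings of [L] come from places *)

Section PlaceOfValuationRing.
Variables (F : finFieldType) (L : fieldExtType (ratfun F)).
Local Notation th := (thetaL L).
Local Notation ev s p := (map_poly (Lconst L) p).[s].

(** Being roots of unity, nonzero constants are units of every valuation ring and have order 0 at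
    every place. *)
Lemma Lconst_root_unity (c : F) : c != 0 -> Lconst L c ^+ #|F|.-1 = 1.
Proof.
move=> c0; have := expf_card c.
rewrite -[in X in X -> _](prednK (ltnW (finNzRing_gt1 F))) exprS => cE.
rewrite -[RHS]mulr1 in cE.
by rewrite -rmorphXn (mulfI c0 cE) rmorph1.
Qed.

(** The witness is the reciprocal polynomial; it serves to pass between theta and its inverse. *)
Lemma eval_reverse (s : L) (f : {poly F}) : s != 0 -> f != 0 ->
  exists2 g : {poly F}, g != 0 & ev s f = s ^+ (size f).-1 * ev s^-1 g.
Proof.
move=> s0 f0; pose d := (size f).-1.
have szf : size f = d.+1 by rewrite /d prednK // size_poly_gt0.
exists (\poly_(i < d.+1) f`_(d - i)).
  apply: contra_neq f0 => g0; have := congr1 (fun g : {poly F} => g`_0) g0.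
  rewrite coef_poly /= subn0 coef0 => fd; apply/eqP.
  by rewrite -lead_coef_eq0 /lead_coef -/d fd.
rewrite horner_coef size_map_poly szf.
rewrite (@horner_coef_wide _ d.+1) ?size_map_poly ?size_poly //.
rewrite mulr_sumr (reindex_inj rev_ord_inj) /=; apply: eq_bigr => i _.
rewrite !coef_map coef_poly ltn_ord /= subSS mulrCA; congr (_ * _).
have le_id : (i <= d)%N by rewrite -ltnS.
by rewrite exprVn -[in s ^+ d](subnK le_id) exprD mulfK ?expf_neq0.
Qed.

(** A valuation ring contains theta or its inverse. Treating both as generators of [k] handles
    finite and infinite places at once. *)
Lemma theta_generates (s : L) : s = th \/ s = th^-1 ->
  (forall p : {poly F}, p != 0 -> ev s p != 0) /\
  (forall c : ratfun F, c != 0 -> exists f g : {poly F},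
    [/\ f != 0, g != 0 & c%:A = ev s f / ev s g]).
Proof.
have t0 := thetaL_neq0 L.
case=> ->.
  by split=> [p|c]; [rewrite thetaL_eval_eq0|apply: ratfun_evalE].
have ti0 : th^-1 != 0 by rewrite invr_eq0.
have inj p : p != 0 -> ev th^-1 p != 0.
  move=> p0; have [g g0 ->] := eval_reverse ti0 p0.
  by rewrite invrK mulf_neq0 ?expf_neq0 // thetaL_eval_eq0.
split=> // c /(ratfun_evalE L)[f [g [f0 g0 ->]]].
have [f' f'0 ->] := eval_reverse t0 f0; have [g' g'0 ->] := eval_reverse t0 g0.
exists (f' * 'X^((size g).-1)), (g' * 'X^((size f).-1)).
rewrite !mulf_neq0 ?expf_neq0 ?polyX_eq0 //; split=> //.
rewrite !rmorphM !rmorphXn /= map_polyX !hornerM !hornerXn !exprVn.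
have := inj _ f'0; have := inj _ g'0.
have := expf_neq0 (size f).-1 t0; have := expf_neq0 (size g).-1 t0.
move: (ev _ f') (ev _ g') (_ ^+ _) (_ ^+ _) => a b c' d *.
by field; do ?[apply/andP; split].
Qed.

(** The terms of the minimal polynomial of [y] over [k], evaluated at [y], sum to zero. Hence two of
    them have the same valuation, and their ratio compares a power of [y] with an element of [k]. *)
Lemma power_proportional (V : subringClosed L) (y : L) :
  (forall z, (z \in V) || (z^-1 \in V)) -> y != 0 ->
  exists j (c : ratfun F), [/\ (0 < j <= \dim {:L})%N, c != 0 &
    y ^+ j / c%:A \in valunit V].
Proof.
move=> Vval y0; pose p := minPoly 1 y.
have /polyOver1P[q pE] : p \is a polyOver 1%VS by apply: minPolyOver.
have szp : (size p <= (\dim {:L}).+1)%N.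
  rewrite size_minPoly ltnS.
  have := dim_Fadjoin (aspace1 L) y; rewrite dimv1 muln1 => <-.
  exact/dimvS/subvf.
have szq : size p = size q by rewrite pE size_map_poly.
have q0 : q != 0.
  by rewrite -size_poly_eq0 -szq size_poly_eq0 monic_neq0 ?monic_minPoly.
pose t (i : 'I_(size q)) := (q`_i)%:A * y ^+ i.
have sum0 : \sum_i t i = 0.
  transitivity p.[y]; last exact/rootP/root_minPoly.
  by rewrite horner_coef szq; apply: eq_bigr => i _; rewrite pE coef_map.
have [||i [j [ij ti tj U]]] := @valunit_sum0 L V Vval _ t => //.
  have lt : ((size q).-1 < size q)%N by rewrite prednK ?size_poly_gt0.
  exists (Ordinal lt); rewrite /t /= mulf_neq0 ?expf_neq0 //.
  by rewrite scaler_eq0 oner_eq0 orbF -/(lead_coef q) lead_coef_eq0.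
wlog lt_ij : i j ij ti tj U / (i < j)%N => [wl|].
  have /orP[le|le] := leq_total i j.
    by apply: (wl i j) => //; rewrite ltn_neqAle ij.
  apply: (wl j i) => //; rewrite 1?eq_sym // -1?valunitV ?invf_div //.
  by rewrite ltn_neqAle le eq_sym ij.
have nz (k : 'I_(size q)) : t k != 0 -> q`_k != 0.
  by apply: contra_neq => qk; rewrite /t qk scale0r mul0r.
exists (j - i)%N, (q`_i / q`_j); split.
- by rewrite subn_gt0 lt_ij; move: szp (ltn_ord j); rewrite szq; lia.
- by rewrite mulf_neq0 ?invr_eq0 ?nz.
rewrite -valunitV; suff <- : t i / t j = (y ^+ (j - i) / (q`_i / q`_j)%:A)^-1 by [].
have nzA (k : 'I_(size q)) : t k != 0 -> (q`_k)%:A != 0 :> L.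
  by move=> /nz qk; rewrite scaler_eq0 negb_or qk oner_neq0.
have -> : (q`_i / q`_j)%:A = (q`_i)%:A / (q`_j)%:A :> L.
  by rewrite -[LHS]/(in_alg L _) fmorph_div.
rewrite /t -[in y ^+ j](subnK (ltnW lt_ij)) exprD.
have := nzA _ ti; have := nzA _ tj; have := expf_neq0 i y0.
have := expf_neq0 (j - i) y0.
move: (_%:A) (_%:A) (_ ^+ _) (_ ^+ _) => a b c' d *.
by field; do ?[apply/andP; split].
Qed.

(** Let [s] be whichever of theta and its inverse lies in [V]. The maximal ideal of [V] cuts out on
    [F[s]] a nonzero prime ideal, generated by an element [P] of least size; up to units every
    element of [F[s]] is a power of [P], and [power_proportional] carries this over to [L]. *)
Lemma place_of_valring (V : subringClosed L) (x : L) :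
  (forall z, (z \in V) || (z^-1 \in V)) -> x \notin V ->
  exists w : place L, forall z, (z \in V) = (0 <= w z)%E.
Proof.
move=> Vval xV.
have constV c : Lconst L c \in V.
  have [->|c0] := eqVneq c 0; first by rewrite rmorph0 rpred0.
  have q1 : (0 < #|F|.-1)%N by have := finNzRing_gt1 F; case: #|F| => [|[]].
  by apply: (valring_root Vval q1); rewrite Lconst_root_unity // rpred1.
have [s sE sV] : exists2 s : L, s = th \/ s = th^-1 & s \in V.
  by have /orP[] := Vval th; [exists th|exists th^-1]; auto.
have [inj frac] := theta_generates sE.
have evV p : ev s p \in V.
  rewrite horner_coef; apply: rpred_sum => i _; rewrite coef_map.
  by apply: rpredM; [apply: constV|apply: rpredX].
have valmaxN z : z \in valmax V -> - z \in valmax V.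
  by move=> zm; rewrite -mulN1r valmaxM // rpredN1.
have constU c : c != 0 -> Lconst L c \in valunit V.
  move=> c0; apply/and3P; split; [by rewrite fmorph_eq0|exact: constV|].
  by rewrite -fmorphV; apply: constV.
pose Q n := `[< exists p : {poly F},
  [/\ p != 0, size p = n & ev s p \in valmax V] >].
(* [x^-1] is in the maximal ideal, and one of its powers is a unit times some [c] of [k]. So [c] is
   in the maximal ideal, and with it the numerator of [c]. *)
have exQ : exists n, Q n.
  have y0 : x^-1 != 0.
    by rewrite invr_eq0; apply: contraNneq xV => ->; apply: rpred0.
  have [j [c [/andP[j0 _] c0 U]]] := power_proportional Vval y0.
  have cA0 : c%:A != 0 :> L by rewrite scaler_eq0 negb_or c0 oner_neq0.
  have cm : c%:A \in valmax V.
    have -> : c%:A = (x^-1 ^+ j / c%:A)^-1 * x^-1 ^+ j.-1 * x^-1.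
      by rewrite -mulrA -exprSr prednK // invf_div divfK ?expf_neq0.
    apply: valmaxM => //; last by apply/orP; right; rewrite invrK.
    rewrite rpredM ?rpredX //; first by case/and3P: U.
    by have := Vval x; rewrite (negbTE xV).
  have [f [g [f0 g0 cE]]] := frac c c0.
  exists (size f); apply/asboolP; exists f; split=> //.
  rewrite -(divfK (inj _ g0) (ev s f)) -cE mulrC.
  by apply: valmaxM; [apply: evV|apply: cm].
case: (ex_minnP exQ) => d /asboolP[P [P0 szP Pm]] dmin.
have d1 : (1 < d)%N.
  rewrite -szP ltnNge; apply/negP => /size1_polyC PE.
  move: Pm; rewrite valmaxE // PE map_polyC hornerC constU ?andbF //.
  by apply: contra_neq P0 => P00; rewrite PE P00.
(* Divide by [P] as long as possible. What remains has a nonzero remainder modulo [P], smaller than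
   [P] and so outside the maximal ideal by minimality. *)
have fP f : f != 0 -> exists a : nat, ev s f / ev s P ^+ a \in valunit V.
  have [n] := ubnP (size f); elim: n f => // n IHn f /ltnSE le_fn f0.
  have [Pf|Pf] := boolP (P %| f).
    have q0 : f %/ P != 0.
      by apply: contra_neq f0 => q0; rewrite -(divpK Pf) q0 mul0r.
    have [|a aP] := IHn (f %/ P) _ q0.
      rewrite size_divp // szP (leq_trans _ le_fn) // ltn_subrL size_poly_gt0 f0.
      by rewrite -subn1 subn_gt0 d1.
    exists a.+1; rewrite -(divpK Pf) rmorphM hornerM exprSr.
    by rewrite -mulf_div divff ?mulr1 ?inj.
  exists 0%N; rewrite expr0 divr1.
  suff : ev s f \notin valmax V by rewrite valmaxE // evV /= negbK.
  apply: contra Pf => fm; rewrite /dvdp; apply: contraT => r0.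
  have rm : ev s (f %% P) \in valmax V.
    have -> : f %% P = f - f %/ P * P by rewrite {2}(divp_eq f P) addrC addKr.
    rewrite rmorphB rmorphM hornerD hornerN hornerM.
    by apply: (valmaxD Vval); [|apply: valmaxN; apply: valmaxM; first apply: evV].
  have /dmin : Q (size (f %% P)).
    by apply/asboolP; exists (f %% P); split; [apply: r0| |apply: rm].
  by rewrite -szP leqNgt ltn_modp P0.
(* The exponent given by [power_proportional] varies with [y], but always divides the factorial of
   the degree of [L] over [k]. *)
apply: (@place_of_discrete_valring L V (ev s P) (\dim {:L})`!) => //.
- exact: fact_gt0.
- exact: inj.
move=> y y0; have [j [c [jd c0 U]]] := power_proportional Vval y0.
have [f [g [f0 g0 cE]]] := frac c c0.
have [a aP] := fP f f0; have [b bP] := fP g g0.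
have U2 : y ^+ j / ev s P ^ (a%:Z - b%:Z) \in valunit V.
  have -> : y ^+ j / ev s P ^ (a%:Z - b%:Z) =
     (y ^+ j / c%:A) * ((ev s f / ev s P ^+ a) * (ev s g / ev s P ^+ b)^-1).
    rewrite cE expfzDr ?inj // -invr_expz -!exprnP.
    have := expf_neq0 a (inj _ P0); have := expf_neq0 b (inj _ P0).
    have := inj _ f0; have := inj _ g0.
    move: (ev s f) (ev s g) (_ ^+ a) (_ ^+ b) (y ^+ j) => *.
    by field; do ?[apply/andP; split].
  by apply: valunitM => //; apply: valunitM; rewrite ?valunitV.
have /dvdnP[k kE] : (j %| (\dim {:L})`!)%N by rewrite dvdn_fact.
exists ((a%:Z - b%:Z) * k); have := valunitX k U2.
by rewrite exprMn -exprM exprVn mulnC -kE exprnP exprz_exp.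
Qed.
End PlaceOfValuationRing.

(** * Orders at a place *)

Section PlaceTheory.
Variables (K : fieldType) (w : place K).

Lemma place_ord1 : w 1 = 0%E.
Proof.
have [a wa] := place_ord_fin w (oner_neq0 K).
have := place_ordM w 1 1; rewrite mulr1 wa -EFinD => -[] E.
by congr (_%:E%E); lia.
Qed.

Lemma place_ordXn x (a : int) n : w x = a%:E%E -> w (x ^+ n) = (a *+ n)%:E%E.
Proof.
move=> wx; elim: n => [|n IHn]; first by rewrite place_ord1.
by rewrite exprS place_ordM IHn wx -EFinD mulrS.
Qed.

Lemma place_ordV x (a : int) : x != 0 -> w x = a%:E%E -> w x^-1 = (- a)%:E%E.
Proof.
move=> x0 wx; have [b wb] := place_ord_fin w (invr_neq0 x0).
have := place_ordM w x x^-1; rewrite divff // place_ord1 wx wb -EFinD => -[] E.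
by congr (_%:E%E); lia.
Qed.

Lemma place_ord_unity x n : (0 < n)%N -> x ^+ n = 1 -> w x = 0%E.
Proof.
move=> n0 xn; have x0 : x != 0.
  by apply: contra_eq_neq xn => ->; rewrite expr0n gtn_eqF // eq_sym oner_neq0.
have [a wa] := place_ord_fin w x0.
have := place_ordXn n wa; rewrite xn place_ord1 wa => -[] E.
congr (_%:E%E); apply/eqP; have /eqP := esym E.
by rewrite mulrn_eq0 gtn_eqF.
Qed.

Lemma place_ordN x : w (- x) = w x.
Proof.
rewrite -mulN1r place_ordM (@place_ord_unity (-1) 2) ?add0e //.
by rewrite sqrrN expr1n.
Qed.

Lemma place_ord_geD c x y : (c <= w x)%E -> (c <= w y)%E -> (c <= w (x + y)%R)%E.
Proof.
by move=> cx cy; apply: le_trans (place_ordD w x y); rewrite le_min cx.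
Qed.

Lemma place_ord_ltD c x y : (c < w x)%E -> (c < w y)%E -> (c < w (x + y)%R)%E.
Proof.
by move=> cx cy; apply: lt_le_trans (place_ordD w x y); rewrite lt_min cx.
Qed.

Lemma place_ord_ge_sum c (I : Type) (s : seq I) (P : pred I) (t : I -> K) :
  (forall i, P i -> (c <= w (t i))%E) -> (c <= w (\sum_(i <- s | P i) t i)%R)%E.
Proof.
move=> ct; apply: (big_ind (fun z => (c <= w z)%E)) => //.
  by rewrite place_ord0 leey.
exact: place_ord_geD.
Qed.

Lemma place_ordD_eq x y : (w x < w y)%E -> w (x + y) = w x.
Proof.
move=> lt_xy; apply/le_anti/andP; split; last first.
  by rewrite place_ord_geD // ltW.
rewrite leNgt; apply/negP => lt_x.
have : (w x < w (x + y - y)%R)%E by rewrite place_ord_ltD ?place_ordN.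
by rewrite addrK ltxx.
Qed.
End PlaceTheory.

(** * Existence of places and separation by them *)

Section PlacesOfFunctionField.
Variables (F : finFieldType) (L : fieldExtType (ratfun F)).
Local Notation th := (thetaL L).
Local Notation ev s p := (map_poly (Lconst L) p).[s].

(** Powers of [y] depend only on the residue of the monomial modulo [Q]. There are finitely many
    residues, so two powers of [y] coincide. *)
Lemma algebraic_root_unity (y : L) (Q : {poly F}) :
  y != 0 -> Q != 0 -> ev y Q = 0 -> exists2 n, (0 < n)%N & y ^+ n = 1.
Proof.
move=> y0 Q0 Qy; pose T := {ffun 'I_(size Q) -> F}.
pose h (i : 'I_(#|{: T}|.+1)) : T := [ffun j : 'I_(size Q) => ('X^i %% Q)`_j].
have evX n : y ^+ n = ev y ('X^n %% Q).
  have := congr1 (fun p : {poly F} => ev y p) (divp_eq 'X^n Q).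
  by rewrite /= rmorphD rmorphM hornerD hornerM Qy mulr0 add0r map_polyXn hornerXn.
have [i [j [hij ij]]] : exists i j, h i = h j /\ (i < j)%N.
  have /injectivePn[i [j ij hij]] : ~~ injectiveb h.
    by apply/injectiveP => /leq_card; rewrite card_ord ltnn.
  have /orP[le|le] := leq_total i j.
    by exists i, j; rewrite ltn_neqAle ij.
  by exists j, i; rewrite ltn_neqAle eq_sym ij.
have eq_mod : 'X^i %% Q = 'X^j %% Q.
  apply/polyP => n; have [lt_n|le_n] := ltnP n (size Q).
    by have /ffunP/(_ (Ordinal lt_n)) := hij; rewrite !ffunE.
  by rewrite !nth_default // (leq_trans _ le_n) // ltnW // ltn_modp.
exists (j - i)%N; first by rewrite subn_gt0.
apply: (mulfI (expf_neq0 i y0)).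
by rewrite -exprD subnKC ?mulr1 ?evX ?eq_mod // ltnW.
Qed.

(** If [x] belonged to [F[x^-1]], then [x^-1] would be algebraic over the finite field [F], hence a
    root of unity. So some valuation ring contains [F[x^-1]] and avoids [x]. *)
Lemma place_pole (x : L) : x != 0 ->
  (forall n, (0 < n)%N -> x ^+ n != 1) -> exists w : place L, (w x < 0)%E.
Proof.
move=> x0 xn.
pose A : {pred L} := fun z => `[< exists p : {poly F}, z = ev x^-1 p >].
have Aring : subring_closed A.
  split=> [|_ _ /asboolP[p ->] /asboolP[r ->]|_ _ /asboolP[p ->] /asboolP[r ->]].
  - by apply/asboolP; exists 1; rewrite rmorph1 hornerC.
  - by apply/asboolP; exists (p - r); rewrite rmorphB hornerD hornerN.
  - by apply/asboolP; exists (p * r); rewrite rmorphM hornerM.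
pose S : subringClosed L := HB.pack A (GRing.isSubringClosed.Build L A Aring).
have xS : x \notin S.
  apply/negP => /asboolP[p xE].
  (* The constant term [1] keeps this polynomial nonzero. *)
  have [|||n n0 /eqP] := @algebraic_root_unity x^-1 (1 - 'X * p).
  - by rewrite invr_eq0.
  - apply/eqP => /(congr1 (fun q : {poly F} => q.[0])).
    by rewrite !hornerE /= => /eqP; rewrite ?(mul0r, subr0) oner_eq0.
  - rewrite rmorphB rmorphM rmorph1 /= map_polyX hornerD hornerN hornerM.
    by rewrite hornerX hornerC -xE mulVf ?subrr.
  by rewrite exprVn invr_eq1 (negbTE (xn n n0)).
have yS : x^-1 \in S by apply/asboolP; exists 'X; rewrite map_polyX hornerX.
have [V [_ xV Vval]] := valuation_ring_avoiding xS yS.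
have [w wV] := place_of_valring Vval xV.
by exists w; rewrite ltNge -wV.
Qed.

Lemma thetaL_not_unity n : (0 < n)%N -> th ^+ n != 1.
Proof.
move=> n0; rewrite -subr_eq0.
have -> : th ^+ n - 1 = ev th ('X^n - 1).
  by rewrite rmorphB rmorph1 /= map_polyXn hornerD hornerN hornerXn hornerC.
rewrite thetaL_eval_eq0 -size_poly_eq0 -['X^n - 1]/('X^n - 1%:P).
by rewrite size_XnsubC.
Qed.

Lemma place_ord_const (w : place L) (c : F) : c != 0 -> w (Lconst L c) = 0%E.
Proof.
move=> c0; apply: place_ord_unity (Lconst_root_unity L c0).
by have := finNzRing_gt1 F; case: #|F| => [|[]].
Qed.

Lemma place_ord_const_ge0 (w : place L) (c : F) : (0 <= w (Lconst L c))%E.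
Proof.
have [->|/place_ord_const ->//] := eqVneq c 0.
by rewrite rmorph0 place_ord0 leey.
Qed.

(** When theta has a pole, the leading term of a polynomial in theta dominates, so its order is its
    degree times [w th]. The ramification index is [- w th]. *)
Lemma divides_inftyP (w : place L) : (w th < 0)%E -> divides_infty w.
Proof.
have [a wa] := place_ord_fin w (thetaL_neq0 L); rewrite wa lte_fin => a0.
have wE p : p != 0 -> w (ev th p) = (a *+ (size p).-1)%:E%E.
  elim/poly_ind: p => [|p c IHp]; first by rewrite eqxx.
  have [->|p0] := eqVneq p 0.
    rewrite mul0r add0r polyC_eq0 map_polyC hornerC => c0.
    by rewrite place_ord_const // size_polyC c0.
  move=> _; rewrite rmorphD rmorphM /= map_polyX map_polyC hornerMXaddC.
  rewrite size_MXaddC (negbTE p0) /=.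
  have sp : (0 < size p)%N by rewrite size_poly_gt0.
  have wp : w (ev th p * th) = (a *+ size p)%:E%E.
    by rewrite place_ordM wa IHp // -EFinD -mulrSr prednK.
  rewrite place_ordD_eq wp //; apply: lt_le_trans (place_ord_const_ge0 w c).
  by rewrite lte_fin pmulrn_llt0.
exists `|a|%N; first by rewrite absz_gt0 lt_eqF.
move=> x; rewrite /= ; have [->|x0] := eqVneq x 0.
  rewrite scale0r place_ord0 ord_infty0.
  by rewrite -[`|a|%N]prednK ?enatmul_pinfty // absz_gt0 lt_eqF.
have [f [g [f0 g0 xE]]] := fracP x0.
have gA0 : ev th g != 0 by rewrite thetaL_eval_eq0.
have -> : x%:A = ev th f / ev th g.
  by rewrite xE -!thetaL_evalE -[LHS]/(in_alg L _) fmorph_div.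
rewrite place_ordM (place_ordV gA0 (wE _ g0)) wE // xE ord_inftyE // -EFinD.
rewrite -EFin_natmul; congr (_%:E%E).
have := size_poly_gt0 f; have := size_poly_gt0 g; rewrite f0 g0.
case: (size f) (size g) => // sf [|sg] // _ _ /=.
rewrite -(mulr_natl a sf) -(mulr_natl a sg) -(mulr_natl _ `|a|) !natz ltz0_abs //.
rewrite -[sf.+1]addn1 -[sg.+1]addn1 !PoszD.
by ring.
Qed.

Lemma exists_infinite_place : exists w : place L, divides_infty w.
Proof.
have [w wth] := place_pole (thetaL_neq0 L) thetaL_not_unity.
by exists w; apply: divides_inftyP.
Qed.

Lemma exists_finite_place : exists w : place L, (0 <= w th)%E.
Proof.
have t0 := thetaL_neq0 L.
have [||w wth] := @place_pole th^-1; first by rewrite invr_eq0.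
  by move=> n n0; rewrite exprVn invr_eq1 thetaL_not_unity.
exists w; have [a wa] := place_ord_fin w t0.
by move: wth; rewrite (place_ordV t0 wa) wa lte_fin lee_fin; lia.
Qed.

(** A nonzero [x] has a pole unless it is a root of unity, and a root of unity has order 0 at an
    infinite place, of which there is at least one. *)
Lemma places_separate (x : L) :
  (forall w : place L, (0 <= w x)%E) ->
  (forall w : place L, divides_infty w -> (0 < w x)%E) -> x = 0.
Proof.
move=> xge0 xgt0; apply/eqP; apply: contraT => x0.
have [w winf] := exists_infinite_place.
have [[n n0 xn]|no_root] := pselect (exists2 n, (0 < n)%N & x ^+ n = 1).
  by have := xgt0 w winf; rewrite (place_ord_unity w n0 xn) ltxx.
have [|v] := place_pole x0; last by rewrite ltNge xge0.
by move=> n n0; apply: contra_notN no_root => /eqP xn; exists n.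
Qed.
End PlacesOfFunctionField.

(** * Points of the tensor power as classes of polynomials *)

Section CarlitzTensor.
Variables (F : finFieldType) (L : fieldExtType (ratfun F)).
Local Notation th := (thetaL L).
Local Notation q := #|F|.
Local Notation frob := (frobq (Lconst L)).
Local Notation T := ('X - th%:P : {poly L}).

(* C^{(x) n}(L) is the cokernel of (t - theta)^n - tau on L[t]. *)
Definition carlitz_diff (n : nat) (g : {poly L}) : {poly L} :=
  T ^+ n * g - map_poly frob g.

Lemma carlitz_diffD n g h :
  carlitz_diff n (g + h) = carlitz_diff n g + carlitz_diff n h.
Proof. by rewrite /carlitz_diff rmorphD mulrDr opprD addrACA. Qed.

Lemma frobq_Lconst (c : F) : frob (Lconst L c) = Lconst L c.
Proof. by rewrite /frobq -rmorphXn expf_card. Qed.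

(** Frobenius fixes the constants from [F], so the image of [carlitz_diff] is stable under
    multiplication by polynomials over [F]. *)
Lemma carlitz_diffM n (a : {poly F}) g :
  map_poly (Lconst L) a * carlitz_diff n g =
  carlitz_diff n (map_poly (Lconst L) a * g).
Proof.
rewrite /carlitz_diff rmorphM mulrBr mulrCA; congr (_ - _ * _).
by apply/polyP => i; rewrite !coef_map /= frobq_Lconst.
Qed.

(** The sum has one term, or none in the last row, where [tau] of the first coordinate appears
    instead. *)
Lemma carlitz_scaleX m (P : carlitz_tensor L m.+1) (i : 'I_m.+1) :
  ('X *: P : 'cV[L]__) i 0 = th * (P : 'cV[L]__) i 0
    + \sum_(j < m.+1 | j == i.+1 :> nat) (P : 'cV[L]__) j 0
    + (if i == m :> nat then (P : 'cV[L]__) ord0 0 ^+ q else 0).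
Proof.
rewrite -[_ *: _]/(tw_actmx (carlitz _ _ _ 'X) (P : 'cV[L]_m.+1)).
rewrite carlitzX !tw_actmxDl !mxE; congr (_ + _ + _).
- rewrite (bigD1 i) //= mxE eqxx mulr1n tw_act_const mulr_algl big1 ?addr0 //.
  by move=> j ji; rewrite mxE eq_sym (negbTE ji) mulr0n tw_act0l.
- rewrite [RHS]big_mkcond; apply: eq_bigr => j _; rewrite mxE.
  by case: eqP => _; [apply: tw_act1|apply: tw_act0l].
rewrite (bigD1 ord0) //= mxE andbT eqSS big1 ?addr0 => [|j j0].
  by case: ifP => _; [apply: tw_act_tau|apply: tw_act0l].
by rewrite mxE -[_ == 0%N]/(j == ord0) (negbTE j0) andbF tw_act0l.
Qed.

Lemma carlitz_scaleC n (c : F) (P : carlitz_tensor L n) (i : 'I_n) :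
  (c%:P *: P : 'cV[L]__) i 0 = Lconst L c * (P : 'cV[L]__) i 0.
Proof.
rewrite -[_ *: _]/(tw_actmx (carlitz _ _ _ c%:P) (P : 'cV[L]_n)).
rewrite carlitzC mxE (bigD1 i) //= !mxE eqxx mulr1 tw_act_const big1 ?addr0.
  by rewrite /= mulr_algl.
by move=> j ji; rewrite !mxE eq_sym (negbTE ji) mulr0 tw_act0l.
Qed.

Lemma poly_of_pointD n (P Q : carlitz_tensor L n) :
  poly_of_point (P + Q) = poly_of_point P + poly_of_point Q.
Proof.
by rewrite -big_split; apply: eq_bigr => j _; rewrite mxE scalerDl.
Qed.

Lemma poly_of_point0 n : poly_of_point (0 : carlitz_tensor L n) = 0.
Proof. by apply: big1 => j _; rewrite mxE scale0r. Qed.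

Lemma poly_of_point_scaleC n (c : F) (P : carlitz_tensor L n) :
  poly_of_point (c%:P *: P) = (Lconst L c)%:P * poly_of_point P.
Proof.
rewrite mul_polyC scaler_sumr; apply: eq_bigr => j _.
by rewrite carlitz_scaleC scalerA.
Qed.

(** Write [t] as theta plus [t - theta]. Multiplication by [t - theta] shifts the coefficients and
    pushes the top one, stored at [ord0], to degree [n = m.+1] in [t - theta]; the action of [t]
    puts its [q]-th power in degree 0 instead. *)
Lemma poly_of_point_scaleX m (P : carlitz_tensor L m.+1) :
  poly_of_point ('X *: P) = 'X * poly_of_point P
    - carlitz_diff m.+1 ((P : 'cV[L]__) ord0 0)%:P.
Proof.
have -> : 'X * poly_of_point P = th *: poly_of_point P + T * poly_of_point P.
  by rewrite mulrBl mul_polyC addrC subrK.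
have -> : T * poly_of_point P = (P : 'cV[L]__) ord0 0 *: T ^+ m.+1 +
    \sum_(j < m) (P : 'cV[L]__) (rev_ord (widen_ord (leqnSn m) j)) 0 *: T ^+ j.+1.
  rewrite /poly_of_point big_ord_recr /= mulrDr addrC mulr_sumr.
  have -> : rev_ord ord_max = ord0 :> 'I_m.+1 by apply: val_inj; rewrite /= subnn.
  rewrite -scalerAr -exprS; congr (_ + _); apply: eq_bigr => j _.
  by rewrite -scalerAr -exprS.
rewrite /carlitz_diff map_polyC /= [_ * _%:P]mulrC mul_polyC opprB.
have arrange (a b c d : {poly L}) : a + (b + c) + (d - b) = a + (d + c).
  by rewrite [d - b]addrC addrA -[_ + _ - b]addrA -[_ + _ + d]addrA; congr (_ + _);
     rewrite [b + c]addrC addrK addrC.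
rewrite arrange {arrange} /poly_of_point scaler_sumr [LHS]big_ord_recl.
rewrite [X in _ = X + _]big_ord_recl addrACA -big_split /=; congr (_ + _).
  rewrite carlitz_scaleX /= subSS subn0 eqxx big_pred0 ?addr0 => [|j]; last first.
    by apply/negbTE; rewrite neq_ltn ltn_ord.
  by rewrite expr0 scalerA scalerDl -[(frob _)%:P]alg_polyC.
apply: eq_bigr => j _; rewrite carlitz_scaleX.
have ltjm := ltn_ord j.
rewrite (big_pred1 (rev_ord (widen_ord (leqnSn m) j))) => [|k]; last first.
  by rewrite -[RHS]/(val k == (m.+1 - j.+1)%N) /= /bump add1n !subSS -subSn.
rewrite ifN ?addr0 /= /bump add1n ?scalerDl ?scalerA //.
by rewrite subSS neq_ltn ltn_subrL (leq_ltn_trans _ ltjm).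
Qed.

Lemma poly_of_point_scale n (a : {poly F}) (P : carlitz_tensor L n) :
  (0 < n)%N -> exists g, poly_of_point (a *: P) =
    map_poly (Lconst L) a * poly_of_point P - carlitz_diff n g.
Proof.
case: n P => // m P _.
elim/poly_ind: a P => [|a c IHa] P.
  exists 0; rewrite scale0r rmorph0 mul0r poly_of_point0.
  by rewrite /carlitz_diff mulr0 rmorph0 !subr0.
have [g gE] := IHa ('X *: P).
exists (map_poly (Lconst L) a * ((P : 'cV[L]__) ord0 0)%:P + g).
rewrite scalerDl poly_of_pointD -scalerA gE poly_of_point_scaleC.
rewrite poly_of_point_scaleX mulrBr carlitz_diffM carlitz_diffD.
have -> : map_poly (Lconst L) (a * 'X + c%:P) =
    map_poly (Lconst L) a * 'X + (Lconst L c)%:P.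
  by rewrite rmorphD rmorphM /= map_polyX map_polyC.
move: (carlitz_diff _ (_ * _)) (carlitz_diff _ g) => u v.
rewrite mulrDl mulrA [- (u + v)]opprD -!addrA.
by congr (_ + _); rewrite addrA addrC.
Qed.

(** Turns a relation between points into an equation in [L[t]], to which orders at places apply. *)
Lemma carlitz_relation n (I : Type) (s : seq I) (a : I -> {poly F})
    (P : I -> carlitz_tensor L n) : (0 < n)%N ->
  \sum_(i <- s) a i *: P i = 0 ->
  exists g, \sum_(i <- s) map_poly (Lconst L) (a i) * poly_of_point (P i) =
    carlitz_diff n g.
Proof.
move=> n0 sum0.
suff [g gE] : exists g, poly_of_point (\sum_(i <- s) a i *: P i) =
    \sum_(i <- s) map_poly (Lconst L) (a i) * poly_of_point (P i)
    - carlitz_diff n g.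
  exists g; apply/eqP; rewrite -subr_eq0 -gE sum0; exact/eqP/poly_of_point0.
elim: s {sum0} => [|i s [g IHs]].
  exists 0; rewrite !big_nil poly_of_point0 /carlitz_diff mulr0 rmorph0.
  by rewrite !subr0.
rewrite !big_cons poly_of_pointD IHs.
have [h ->] := poly_of_point_scale (a i) (P i) n0.
exists (h + g); rewrite carlitz_diffD [- (_ + carlitz_diff n g)]opprD.
exact: addrACA.
Qed.
End CarlitzTensor.

(** * Orders of coefficients and independence of points *)

Section OrdOfRelation.
Variables (F : finFieldType) (L : fieldExtType (ratfun F)).
Local Notation th := (thetaL L).
Local Notation q := #|F|.
Local Notation T := ('X - th%:P : {poly L}).

Lemma poly_ord_le (w : place L) (p : {poly L}) i : (poly_ord w p <= w p`_i)%E.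
Proof.
have [lt_i|le_i] := ltnP i (size p).
  exact: (bigmin_le +oo%E (Ordinal lt_i) (fun j => w p`_j)).
by rewrite nth_default // place_ord0 leey.
Qed.

Lemma ord_coef_scalar (w : place L) c (a : {poly F}) (p : {poly L}) :
  (forall i, (c <= w p`_i)%E) ->
  forall i, (c <= w (map_poly (Lconst L) a * p)%R`_i)%E.
Proof.
move=> cp i; rewrite coefM; apply: place_ord_ge_sum => j _.
rewrite coef_map place_ordM; apply: le_trans (cp (i - j)%N) _.
by rewrite leeDr // place_ord_const_ge0.
Qed.

Section FinitePlace.
Variables (w : place L) (n : nat).
Hypothesis w_fin : (0 <= w th)%E.

Lemma ord_coef_theta c (g : {poly L}) : (forall i, (c <= w g`_i)%E) ->
  forall i, (c <= w (T ^+ n * g)%R`_i)%E.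
Proof.
move=> cg; elim: n => [|m IHm] i; first by rewrite expr0 mul1r.
rewrite exprS -mulrA mulrBl coefB coefXM coefCM; apply: place_ord_geD.
  by case: i => [|i]; rewrite ?place_ord0 ?leey //= IHm.
by rewrite place_ordN place_ordM (le_trans (IHm i)) // leeDr.
Qed.

Lemma carlitz_diff_integral (g : {poly L}) :
  (forall i, (0 <= w g`_i)%E) -> forall i, (0 <= w (carlitz_diff n g)`_i)%E.
Proof.
move=> g0 i; rewrite coefB; apply: place_ord_geD; first exact: ord_coef_theta.
rewrite place_ordN coef_map /= /frobq.
have [->|gi0] := eqVneq g`_i 0.
  by rewrite expr0n gtn_eqF ?place_ord0 ?leey // ltnW // finNzRing_gt1.
have [b wb] := place_ord_fin w gi0; have := g0 i.
by rewrite (place_ordXn _ wb) wb !lee_fin; apply: mulrn_wge0.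
Qed.

(* The pole of tau g dominates that of (t - theta)^n g. *)
Lemma carlitz_diff_pole (g : {poly L}) : (exists i, (w g`_i < 0)%E) ->
  exists a : int, [/\ a < 0,
    exists i, w (carlitz_diff n g)`_i = (a *+ q)%:E%E &
    forall i, ((a *+ q)%:E <= w (carlitz_diff n g)`_i)%E].
Proof.
move=> [i0 wi0].
have lt_i0 : (i0 < size g)%N.
  by rewrite ltnNge; apply/negP => le; move: wi0; rewrite nth_default // place_ord0.
have [i _ imin] :=
  arg_minP (P := predT) (i0 := Ordinal lt_i0) (fun j => w g`_j) isT.
have wi : (w g`_i < 0)%E by apply: le_lt_trans (imin (Ordinal lt_i0) isT) wi0.
have gi0 : g`_i != 0 by apply: contraTneq wi => ->; rewrite place_ord0.
have [a wa] := place_ord_fin w gi0.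
have a0 : a < 0 by move: wi; rewrite wa lte_fin.
have gmin j : (a%:E <= w g`_j)%E.
  have [lt_j|le_j] := ltnP j (size g); last first.
    by rewrite nth_default // place_ord0 leey.
  by rewrite -wa (imin (Ordinal lt_j)).
have q1 := finNzRing_gt1 F.
(* This strict inequality excludes cancellation: at an index of minimal order, [tau g] has a
   strictly worse pole than any coefficient of the other term. *)
have aq_lt : a *+ q < a.
  by rewrite -mulr_natl natz; move: #|F| q1 => c; clear -a0; nia.
exists a; split=> //.
  exists i; rewrite coefB addrC place_ordD_eq place_ordN coef_map /=
      (place_ordXn _ wa) //.
  by apply: lt_le_trans (ord_coef_theta gmin i); rewrite lte_fin.
move=> j; rewrite coefB; apply: place_ord_geD.
  by apply: le_trans (ord_coef_theta gmin j); rewrite lee_fin ltW.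
rewrite place_ordN coef_map /= /frobq; have [->|gj0] := eqVneq g`_j 0.
  by rewrite expr0n gtn_eqF ?place_ord0 ?leey // ltnW.
have [b wb] := place_ord_fin w gj0; have := gmin j.
by rewrite (place_ordXn _ wb) wb !lee_fin lerMn2r => ->; rewrite orbT.
Qed.
End FinitePlace.

(** For positive [n], multiplying by the monic [T ^+ n] raises the degree above that of [tau g] and
    keeps the leading coefficient of [g]. *)
Lemma carlitz_diff_lead n (g : {poly L}) : (0 < n)%N -> g != 0 ->
  (carlitz_diff n g)`_(n + size g).-1 = lead_coef g.
Proof.
move=> n0 g0; have Tm : T ^+ n \is monic by rewrite monic_exp ?monicXsubC.
have szT : size (T ^+ n) = n.+1 by rewrite size_exp_XsubC.
have szg : (0 < size g)%N by rewrite size_poly_gt0.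
have szTg : size (T ^+ n * g) = (n + size g)%N.
  by rewrite size_monicM // szT addSn.
rewrite coefB -szTg -/(lead_coef _) lead_coef_monicM // nth_default ?subr0 //.
rewrite szTg (leq_trans (size_poly _ _)) //.
by case: n n0 {Tm szT szTg} => // n _; rewrite addSn leq_addl.
Qed.

Lemma lin_indep_of_ord (n l : nat) (P : 'I_l -> carlitz_tensor L n) :
  (0 < n)%N ->
  lin_indep (fun i => poly_of_point (P i) : Lt_module L) ->
  (forall (i : 'I_l) (w : place L), divides_infty w ->
     (0 < poly_ord w (poly_of_point (P i)))%E) ->
  (forall (i : 'I_l) (w : place L), ~ divides_infty w ->
     ((1 - q%:Z)%:E <= poly_ord w (poly_of_point (P i)))%E) ->
  lin_indep P.
Proof.
move=> n0 f_indep f_inf f_fin s a s_uniq sum0.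
have [g gE] := carlitz_relation n0 sum0.
suff g0 : g = 0.
  apply: f_indep => //; rewrite -[LHS]/(\sum_(i <- s) _ * _) gE g0.
  by rewrite /carlitz_diff mulr0 rmorph0 subrr.
have ord_sum (w : place L) c :
    (forall i, (c <= poly_ord w (poly_of_point (P i)))%E) ->
    forall j, (c <= w (carlitz_diff n g)`_j)%E.
  move=> cP j; rewrite -gE coef_sum; apply: place_ord_ge_sum => i _.
  by apply: ord_coef_scalar => k; apply: le_trans (cP i) (poly_ord_le _ _ _).
apply/eqP; apply: contraT => gn0.
(* Orders are integers, so the strict bound can be restated as [1 <=], the form that [ord_sum]
   takes. *)
have lead_inf w : divides_infty w -> (1%:E <= w (lead_coef g))%E.
  move=> winf; rewrite -(carlitz_diff_lead n0 gn0); apply: ord_sum => i.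
  by have := f_inf i w winf; case: (poly_ord _ _).
suff : lead_coef g = 0 by move/eqP; rewrite lead_coef_eq0 (negbTE gn0).
apply: places_separate => w.
  have [winf|wfin] := pselect (divides_infty w).
    by apply: le_trans (lead_inf w winf); rewrite lee_fin.
  have wth : (0 <= w th)%E by rewrite leNgt; apply/negP => /divides_inftyP.
  rewrite leNgt; apply/negP => lead_neg.
  have [|a0 [a_lt0 [i fi] _]] := @carlitz_diff_pole w n wth g.
    by exists (size g).-1.
  (* Since [a0 <= -1], this coefficient has order [a0 * q <= - q], below the bound [1 - q]. *)
  have := ord_sum w _ (fun i => f_fin i w wfin) i; rewrite fi lee_fin.
  have := finNzRing_gt1 F; rewrite -mulr_natl natz.
  have : (a0 + 1) * q%:Z <= 0 by rewrite mulr_le0_ge0 //; lia.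
  by rewrite mulrDl mul1r [q%:Z * _]mulrC; lia.
by move=> /lead_inf; apply: lt_le_trans; rewrite lte_fin.
Qed.
End OrdOfRelation.

(** * Rank and tensor product over a fraction field *)

Section Denominators.
Variables (A : idomainType) (B : fieldType) (phi : {rmorphism A -> B}).
Hypothesis phi_inj : injective phi.
Hypothesis phi_frac : forall x, exists a d, d != 0 /\ x * phi d = phi a.

Lemma common_denominator (I : eqType) (s : seq I) (x : I -> B) :
  exists (d : A) (y : I -> A), d != 0 /\ {in s, forall i, x i * phi d = phi (y i)}.
Proof.
elim: s => [|i s [d [y [d0 dy]]]]; first by exists 1, (fun=> 0); rewrite oner_neq0.
have [a [c [c0 xc]]] := phi_frac (x i).
exists (d * c), (fun j => if j == i then a * d else y j * c).
rewrite mulf_neq0 //; split=> // j; rewrite inE; case: eqP => [-> _|_ /= js].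
  by rewrite [d * c]mulrC !rmorphM mulrA xc.
by rewrite !rmorphM mulrA dy.
Qed.

(** More rows than columns give a kernel vector over [B]; clearing its denominators brings it back
    to [A]. *)
Lemma linear_dependence (m l : nat) (a : 'I_m -> 'I_l -> A) : (l < m)%N ->
  exists2 v : 'I_m -> A, exists i, v i != 0 & forall j, \sum_i v i * a i j = 0.
Proof.
move=> lt_lm; pose M : 'M[B]_(m, l) := \matrix_(i, j) phi (a i j).
have /rowV0Pn[u uM u0] : kermx M != 0.
  rewrite -mxrank_eq0 mxrank_ker subn_eq0 -ltnNge.
  exact: leq_ltn_trans (rank_leq_col M) lt_lm.
have [d [v [d0 dv]]] := common_denominator (enum 'I_m) (u 0).
have {}dv i : u 0 i * phi d = phi (v i) by apply: dv; rewrite mem_enum.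
have phid : phi d != 0 by rewrite -(rmorph0 phi) (inj_eq phi_inj).
exists v => [|j].
  have [i ui] : exists i, u 0 i != 0.
    apply: contrapT => none; move/eqP: u0; apply; apply/rowP => i; rewrite mxE.
    by apply/eqP; apply: contrapT => /negP ui; apply: none; exists i.
  exists i; apply: contraNneq ui => vi.
  by have /eqP := dv i; rewrite vi rmorph0 mulf_eq0 (negbTE phid) orbF.
apply: phi_inj; rewrite rmorph_sum rmorph0.
transitivity ((u *m M) 0 j * phi d).
  rewrite mxE mulr_suml; apply: eq_bigr => i _.
  by rewrite rmorphM -dv !mxE mulrAC.
by move/sub_kermxP: uM => ->; rewrite mxE mul0r.
Qed.

Lemma span_rank_le (M : lmodType A) (m l : nat) (e : 'I_l -> M) (f : 'I_m -> M) :
  (forall i, span_of e (f i)) -> lin_indep f -> (m <= l)%N.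
Proof.
move=> fe f_indep; rewrite leqNgt; apply/negP => lt_lm.
have [a aP] := choice fe.
have [v [i vi] v0] := linear_dependence a lt_lm.
have := f_indep (index_enum 'I_m) v (index_enum_uniq _).
have -> : \sum_i v i *: f i = 0.
  transitivity (\sum_j (\sum_i v i * a i j) *: e j).
    under [RHS]eq_bigr do rewrite scaler_suml.
    rewrite exchange_big; apply: eq_bigr => k _; rewrite aP scaler_sumr.
    by apply: eq_bigr => j _; rewrite scalerA.
  by apply: big1 => j _; rewrite v0 scale0r.
by move=> /(_ erefl i (mem_index_enum i)) vi0; rewrite vi0 eqxx in vi.
Qed.

Lemma has_rank_span (M : lmodType A) (l : nat) (e : 'I_l -> M) :
  lin_indep e -> has_rank (span_of e) l.
Proof.
move=> e_indep; split; last by move=> m f; apply: span_rank_le.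
exists e; split=> // i; exists (fun j => (j == i)%:R).
rewrite (bigD1 i) //= eqxx scale1r big1 ?addr0 // => j ji.
by rewrite (negbTE ji) scale0r.
Qed.

Section TensorIndependence.
Variable M : lmodType A.
Local Notation FG := {freeg (M * B)%type}.

(* 0 if d is not a denominator of b. *)
Definition numer (d : A) (b : B) : A :=
  if pselect (exists a, b * phi d = phi a) is left h then projT1 (cid h) else 0.

Lemma numerE d b a : b * phi d = phi a -> numer d b = a.
Proof.
move=> ba; rewrite /numer; case: pselect => [h|[]]; last by exists a.
by case: (cid h) => a' /= E; apply: phi_inj; rewrite -ba E.
Qed.

(* sum (m_i, b_i) |-> sum (d b_i) m_i: since M (x) B is the localization of M,
   an element of the free group is zero in the tensor product exactly when this
   sum is torsion; for d divisible enough it even vanishes. *)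
Definition clear_denom (d : A) : FG -> zmodule M :=
  fglift (fun mb : M * B => numer d mb.2 *: mb.1 : zmodule M).

Lemma clear_denomU d m b : clear_denom d << (m, b) >> = numer d b *: m.
Proof. by rewrite /clear_denom liftU scale1r. Qed.

Lemma clear_denomB d : {morph clear_denom d : x y / x - y}.
Proof. by move=> x y; apply: lift_is_additive. Qed.

Lemma clear_denom0 d : clear_denom d 0 = 0.
Proof. by rewrite -[X in clear_denom d X](subrr 0) clear_denomB subrr. Qed.

Lemma clear_denomD d : {morph clear_denom d : x y / x + y}.
Proof.
move=> x y; rewrite -{1}[y]opprK clear_denomB -(sub0r y) clear_denomB.
by rewrite clear_denom0 sub0r opprK.
Qed.

Lemma denom_mulr b d c a : b * phi d = phi a -> b * phi (d * c) = phi (a * c).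
Proof. by move=> E; rewrite !rmorphM mulrA E. Qed.

(** The free factor [c] makes the induction work: for a difference of two relations, each must
    vanish at a common multiple of the two denominators. *)
Lemma tensor_rel_clear_denom (x : FG) : tensor_rel phi x ->
  exists2 d0, d0 != 0 & forall c, clear_denom (d0 * c) x = 0.
Proof.
elim=> [|{}x y _ [d d0 dx] _ [d' d'0 dy]|m m' b|m b b'|r m b].
- by exists 1; rewrite ?oner_neq0 // => c; rewrite clear_denom0.
- exists (d * d'); rewrite ?mulf_neq0 // => c.
  by rewrite clear_denomB -mulrA dx mulrCA dy subrr.
(* The default value of [numer] is harmless here, since the same scalar multiplies [m + m'], [m] and
   [m']. *)
- exists 1; rewrite ?oner_neq0 // => c.
  by rewrite !clear_denomB !clear_denomU scalerDr addrAC addrK subrr.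
- have [a [d [d0 E]]] := phi_frac b; have [a' [d' [d'0 E']]] := phi_frac b'.
  exists (d * d'); rewrite ?mulf_neq0 // => c; rewrite -mulrA.
  have F := denom_mulr (d' * c) E.
  have F' : b' * phi (d * (d' * c)) = phi (a' * (d * c)).
    by rewrite mulrCA; apply: denom_mulr.
  have FF' : (b + b') * phi (d * (d' * c)) = phi (a * (d' * c) + a' * (d * c)).
    by rewrite mulrDl F F' rmorphD.
  rewrite !clear_denomB !clear_denomU (numerE F) (numerE F') (numerE FF').
  by rewrite scalerDl addrAC addrK subrr.
have [a [d [d0 E]]] := phi_frac b; exists d => // c.
have F := denom_mulr c E.
have F' : (phi r * b) * phi (d * c) = phi (r * (a * c)).
  by rewrite -mulrA F -rmorphM.
rewrite clear_denomB !clear_denomU (numerE F) (numerE F') scalerA.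
by rewrite [r * _]mulrC subrr.
Qed.

(** Applying [clear_denom] at a multiple of both the denominator of the relation and that of the
    coefficients turns a relation in the tensor product into one in [M]. *)
Lemma lin_indep_tensor (I : eqType) (e : I -> M) : lin_indep e ->
  lin_indep (fun i => tensor phi (e i) 1).
Proof.
move=> e_indep s b s_uniq sum0.
have [d [y [d0 dy]]] := common_denominator s b.
pose x : FG := \sum_(i <- s) << (e i, b i) >>.
have /asboolP/tensor_rel_clear_denom[d1 d10 dx] : tensor_relb phi (x - 0).
  apply/pi_tensorP; rewrite raddf0 -[RHS]sum0 raddf_sum; apply: eq_bigr => i _.
  by rewrite -[RHS]/(bc_scale _ _) bc_scale_tensor mulr1.
have lin : clear_denom (d1 * d) x = \sum_(i <- s) (y i * d1) *: e i.
  rewrite /x (big_morph (clear_denom (d1 * d)) (@clear_denomD _) (clear_denom0 _)).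
  rewrite !big_seq; apply: eq_bigr => i si; rewrite clear_denomU.
  rewrite (@numerE _ _ (y i * d1)) // [d1 * d]mulrC.
  by apply: denom_mulr; apply: dy.
have := dx d; rewrite subr0 lin => /(e_indep _ _ s_uniq) y0 i si.
have yi : y i = 0.
  by have /eqP := y0 i si; rewrite mulf_eq0 (negbTE d10) orbF => /eqP.
have phid : phi d != 0 by rewrite -(rmorph0 phi) (inj_eq phi_inj).
by have /eqP := dy i si; rewrite yi rmorph0 mulf_eq0 (negbTE phid) orbF => /eqP.
Qed.
End TensorIndependence.
End Denominators.

(** Selects the decisive term of a relation, both in the construction of a countable basis and in
    the comparison of poles. *)
Lemma last_nonzero (V : nmodType) (s : seq nat) (a : nat -> V) :
  ~ {in s, forall k, a k = 0} ->
  exists k, [/\ k \in s, a k != 0 &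
    forall j, j \in s -> a j != 0 -> (j <= k)%N].
Proof.
move=> none; have exk : exists k, (k \in s) && (a k != 0).
  apply: contrapT => none'; apply: none => k ks; apply/eqP; apply: contrapT.
  by move=> /negP ak; apply: none'; exists k; rewrite ks.
have bnd k : (k \in s) && (a k != 0) -> (k <= \max_(i <- s) i)%N.
  by case/andP=> ks _; apply: (leq_bigmax_seq (F := id)).
case: (ex_maxnP exk bnd) => k /andP[ks ak] kmax; exists k; split=> // j js aj.
by apply: kmax; rewrite js.
Qed.

(** * Extraction of a countable basis *)

Section CountableBasis.
Variables (K : fieldType) (V : lmodType K).

Definition initial_span (v : nat -> V) (n : nat) (x : V) : Prop :=
  exists a : nat -> K, x = \sum_(j < n) a j *: v j.

Lemma initial_spanS v m n x :
  (m <= n)%N -> initial_span v m x -> initial_span v n x.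
Proof.
move=> le_mn [a ->]; exists (fun j => if (j < m)%N then a j else 0).
rewrite (big_ord_widen n (fun j => a j *: v j) le_mn) big_mkcond /=.
by apply: eq_bigr => j _; case: ifP => _; rewrite ?scale0r.
Qed.

Lemma initial_span0 v n : initial_span v n 0.
Proof. by exists (fun=> 0); rewrite big1 // => j _; rewrite scale0r. Qed.

Lemma initial_spanD v n x y :
  initial_span v n x -> initial_span v n y -> initial_span v n (x + y).
Proof.
move=> [a ->] [b ->]; exists (fun j => a j + b j).
by rewrite -big_split; apply: eq_bigr => j _; rewrite scalerDl.
Qed.

Lemma initial_spanZ v n c x : initial_span v n x -> initial_span v n (c *: x).
Proof.
move=> [a ->]; exists (fun j => c * a j).
by rewrite scaler_sumr; apply: eq_bigr => j _; rewrite scalerA.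
Qed.

Lemma initial_span_sum v n (I : eqType) (s : seq I) (P : pred I) (a : I -> K)
    (f : I -> V) :
  (forall i, i \in s -> P i -> a i != 0 -> initial_span v n (f i)) ->
  initial_span v n (\sum_(i <- s | P i) a i *: f i).
Proof.
move=> sf; rewrite big_seq_cond; apply: big_ind => [|x y|i /andP[si Pi]].
- exact: initial_span0.
- exact: initial_spanD.
have [->|ai] := eqVneq (a i) 0; first by rewrite scale0r; apply: initial_span0.
by apply/initial_spanZ/sf.
Qed.

Lemma initial_span_mem v i n : (i < n)%N -> initial_span v n (v i).
Proof.
move=> lt_in; exists (fun j => (j == i)%:R).
rewrite (bigD1 (Ordinal lt_in)) //= eqxx scale1r big1 ?addr0 // => j.
by rewrite -val_eqE /= => /negbTE ->; rewrite scale0r.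
Qed.

(* The basis consists of the v n outside the span of their predecessors. *)
Lemma dim_aleph0_of_seq (v u : nat -> V) :
  (forall x, exists n, initial_span v n x) -> lin_indep u -> dim_aleph0 V.
Proof.
move=> v_span u_indep.
pose S n := `[< ~ initial_span v n (v n) >].
(* Otherwise every vector lies in the span of the first [m], against [m.+1] independent members of
   [u]; a field is its own fraction field, so [span_rank_le] applies. *)
have exS m : exists n, (m <= n)%N && S n.
  apply: contrapT => none.
  have vm n : initial_span v m (v n).
    have [k] := ubnP n; elim: k n => // k IHk n /ltnSE le_nk.
    have [lt_nm|le_mn] := ltnP n m; first exact: initial_span_mem.
    have /asboolPn/contrapT[a ->] : ~~ S n.
      by apply/negP => Sn; apply: none; exists n; rewrite le_mn.
     apply: initial_span_sum => j _ _ _; apply: IHk.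
    exact: leq_trans (ltn_ord j) le_nk.
  have : (m.+1 <= m)%N; last by rewrite ltnn.
  apply: (@span_rank_le K K idfun _ _ V m.+1 m (fun i => v i) (fun i => u i)).
  - by [].
  - by move=> x; exists x, 1; rewrite oner_neq0 mulr1.
  - move=> i; have [n [a ->]] := v_span (u i).
    have [b ->] : initial_span v m (\sum_(j < n) a j *: v j).
      exact: initial_span_sum.
    by exists b.
  move=> s a s_uniq sum0 i si.
  (* Extension by zero, since [u_indep] concerns coefficients indexed by all of [nat]. *)
  pose a' k := if insub k is Some j then a (j : 'I_m.+1) else 0.
  have a'E j : a' (val j) = a j by rewrite /a' valK.
  rewrite -a'E; apply: (u_indep (map val s)); last exact: map_f.
    by rewrite map_inj_uniq //; apply: val_inj.
  by rewrite big_map -[RHS]sum0; apply: eq_bigr => j _; rewrite a'E.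
pose next m := ex_minn (exS m).
have nextP m : [/\ (m <= next m)%N, S (next m) &
    forall n, (m <= n)%N -> S n -> (next m <= n)%N].
  rewrite /next; case: ex_minnP => n /andP[le_mn Sn] nmin; split=> // k le_mk Sk.
  by apply: nmin; rewrite le_mk.
(* [e] enumerates [S] in increasing order. *)
pose e := fix e k := if k is k'.+1 then next (e k').+1 else next 0%N.
have eS k : S (e k) by case: k => [|k]; [case: (nextP 0%N)|case: (nextP (e k).+1)].
have e_lt k : (e k < e k.+1)%N by case: (nextP (e k).+1).
have e_mono i j : (i < j)%N -> (e i < e j)%N.
  exact: (homo_ltn ltn_trans e_lt).
have e_ge k : (k <= e k)%N.
  by elim: k => // k IHk; apply: leq_ltn_trans (e_lt k).
have e_surj m : S m -> exists k, e k = m.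
  move=> Sm; have exk : exists k, (m <= e k)%N by exists m; apply: e_ge.
  case: (ex_minnP exk) => -[|k] le_m kmin.
    exists 0%N; apply/eqP; rewrite eqn_leq le_m andbT.
    by case: (nextP 0%N) => _ _; apply.
  exists k.+1; apply/eqP; rewrite eqn_leq le_m andbT.
  case: (nextP (e k).+1) => _ _; apply=> //; rewrite ltnNge.
  by apply/negP => /kmin; rewrite ltnn.
exists (fun k => v (e k)); split.
  move=> s a s_uniq sum0; apply: contrapT => /last_nonzero[k [ks ak kmax]].
  (* The last vector of a relation would lie in the span of its predecessors, which [S] forbids. *)
  have /asboolP := eS k; apply.
  have -> : v (e k) = - (a k)^-1 *: \sum_(i <- s | i != k) a i *: v (e i).
    move: sum0; rewrite (bigD1_seq k) //= => /eqP; rewrite addr_eq0 => /eqP E.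
    by rewrite scaleNr -scalerN -E scalerA mulVf // scale1r.
  apply/initial_spanZ/initial_span_sum => i si ik ai.
  apply/initial_span_mem/e_mono; rewrite ltn_neqAle ik.
  exact: kmax.
(* Strong induction: a vector that was not selected is a combination of earlier ones, each already
   spanned by selected vectors. *)
have w_span m : exists n, initial_span (fun k => v (e k)) n (v m).
  have [k] := ubnP m; elim: k m => // k IHk m /ltnSE le_mk.
  have [/e_surj[j <-]|/asboolPn/contrapT[a ->]] := boolP (S m).
    by exists j.+1; apply: (@initial_span_mem (fun k => v (e k)) j).
  have /choice[N NP] : forall j : 'I_m, exists n,
      initial_span (fun k => v (e k)) n (v j).
    by move=> j; apply: IHk; apply: leq_trans (ltn_ord j) le_mk.
  exists (\max_j N j); apply: initial_span_sum => j _ _ _.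
  exact: initial_spanS (leq_bigmax j) (NP j).
move=> x; have [m [a ->]] := v_span x.
have /choice[N NP] := w_span.
have [b ->] : initial_span (fun k => v (e k)) (\max_(j < m) N j)
    (\sum_(j < m) a j *: v j).
  by apply: initial_span_sum => j _ _ _; exact: initial_spanS (leq_bigmax j) (NP j).
by exists (index_iota 0 (\max_(j < m) N j)), b; rewrite big_mkord.
Qed.
End CountableBasis.

(** * Infinitely many independent points and countable dimension *)

Section InfiniteRank.
Variables (F : finFieldType) (L : fieldExtType (ratfun F)) (n : nat).
Hypothesis n_gt0 : (0 < n)%N.
Local Notation th := (thetaL L).
Local Notation q := #|F|.

Definition const_point (c : L) : carlitz_tensor L n :=
  \col_(i < n) (if i.+1 == n then c else 0) : 'cV[L]_n.

Lemma poly_of_const_point c : poly_of_point (const_point c) = c%:P.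
Proof.
rewrite /poly_of_point (bigD1 (Ordinal n_gt0)) //= big1 ?addr0 => [|j j0].
  by rewrite mxE /= subn1 prednK // eqxx alg_polyC.
rewrite mxE /= -subSn // subSS ifN ?scale0r //.
have jn0 : (j != 0 :> nat)%N := j0.
by rewrite neq_ltn ltn_subrL lt0n jn0 n_gt0.
Qed.

(* A relation would give f = (t - theta)^n g - tau g with a pole of order
   q k + 1 at w, whereas the order of a pole of such an f is divisible by q. *)
Lemma lin_indep_pole_family (w : place L) (u : L) :
  (0 <= w th)%E -> w u = 1%:E%E ->
  lin_indep (fun j : nat => const_point (u^-1 ^+ (q * j).+1)).
Proof.
move=> wth wu s a s_uniq sum0.
pose c j := u^-1 ^+ (q * j).+1.
have u0 : u != 0 by apply/eqP => u0; move: wu; rewrite u0 place_ord0.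
have wc j : w (c j) = (- (q * j)%N%:Z - 1)%:E%E.
  rewrite /c (place_ordXn _ (place_ordV u0 wu)); congr (_%:E%E).
  by rewrite mulrS -mulr_natr natz mulN1r addrC.
have [g gE] := carlitz_relation n_gt0 sum0.
have fE i : (carlitz_diff n g)`_i = \sum_(j <- s) Lconst L (a j)`_i * c j.
  rewrite -gE coef_sum; apply: eq_bigr => j _.
  by rewrite poly_of_const_point coefMC coef_map.
apply: contrapT => /last_nonzero[k [ks ak kmax]].
have term_ge i j : (w (c j) <= w (Lconst L (a j)`_i * c j)%R)%E.
  by rewrite place_ordM leeDr // place_ord_const_ge0.
have term0 i j : a j = 0 -> Lconst L (a j)`_i * c j = 0.
  by move=> ->; rewrite coef0 [X in X * _]rmorph0 mul0r.
have f_ge i : ((- (q * k)%N%:Z - 1)%:E <= w (carlitz_diff n g)`_i)%E.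
  rewrite fE big_seq; apply: place_ord_ge_sum => j js.
  have [aj|aj] := eqVneq (a j) 0; first by rewrite term0 // place_ord0 leey.
  apply: le_trans (term_ge i j); rewrite wc lee_fin.
  by rewrite lerD2r lerN2 lez_nat leq_mul2l kmax ?orbT.
have q1 := finNzRing_gt1 F.
have [i fi] : exists i, w (carlitz_diff n g)`_i = (- (q * k)%N%:Z - 1)%:E%E.
  (* In this degree [a k] has its leading coefficient, so the term of index [k] has exactly the
     order of [c k]. The other nonzero terms have index below [k], hence poles smaller by at least
     [q]. *)
  exists (size (a k)).-1; set i := _.-1.
  have wk : w (Lconst L (a k)`_i * c k) = (- (q * k)%N%:Z - 1)%:E%E.
    by rewrite place_ordM place_ord_const ?lead_coef_eq0 // add0e wc.
  rewrite fE (bigD1_seq k) //= place_ordD_eq wk //.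
  apply: (@lt_le_trans _ _ (- (q * k)%N%:Z)%:E%E); first by rewrite lte_fin; lia.
  rewrite big_seq_cond; apply: place_ord_ge_sum => j /andP[js jk].
  have [aj|aj] := eqVneq (a j) 0; first by rewrite term0 // place_ord0 leey.
  apply: le_trans (term_ge i j); rewrite wc lee_fin.
  have lt_jk : (j < k)%N by rewrite ltn_neqAle jk kmax.
  have : (q * j + q <= q * k)%N by rewrite -mulnSr leq_mul2l lt_jk orbT.
  move=> le_jk; rewrite -opprD lerN2 -[1]/(1%N : int) -PoszD lez_nat.
  by apply: leq_trans le_jk; rewrite leq_add2l ltnW.
have [g_neg|g_int] := pselect (exists i, (w g`_i < 0)%E); last first.
  have := @carlitz_diff_integral _ _ w n wth g _ i; rewrite fi lee_fin => /(_ _) H.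
  have : (0 <= - (q * k)%N%:Z - 1 :> int)
    by apply: H => j; rewrite leNgt; apply/negP => gj; apply: g_int; exists j.
  by lia.
have [b [_ [i' fi'] bmin]] := carlitz_diff_pole n wth g_neg.
have := f_ge i'; have := bmin i; rewrite fi fi' !lee_fin -mulr_natl natz PoszM.
move: q1 (k%:Z) => q1 k' le1 le2.
(* Both [b * q] and [- (q * k) - 1] are the minimal order of the coefficients, hence equal, and [q]
   would divide 1. *)
have E : q%:Z * (b + k') = -1 by rewrite mulrDr; lia.
have : (q%:Z %| 1)%Z.
  by apply/dvdzP; exists (- (b + k')); rewrite mulNr mulrC E opprK.
by rewrite dvdz1 absz_nat gtn_eqF.
Qed.

(** [L] is finite over [k], and [k] is countable because [F] is finite. So there are countably many
    points [P], and the tensors of the [P] with 1 span over the field. *)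
Lemma tensor_countably_spanned :
  exists v : nat -> base_change (@FracField.tofrac {poly F}) (carlitz_tensor L n),
  forall x, exists m, initial_span v m x.
Proof.
pose T := 'M[({poly F} * {poly F})%type]_(n, \dim {:L}).
pose pt (X : T) : carlitz_tensor L n := \col_(i < n)
  (\sum_j (FracField.tofrac (X i j).1 / FracField.tofrac (X i j).2)
    *: (vbasis {:L})`_j) : 'cV[L]_n.
have pt_surj (P : carlitz_tensor L n) : exists X, pt X = P.
  have rep (x : ratfun F) : exists f : {poly F} * {poly F},
      x = FracField.tofrac f.1 / FracField.tofrac f.2.
    have [->|/fracP[f [g [_ _ ->]]]] := eqVneq x 0; last by exists (f, g).
    by exists (0, 0); rewrite rmorph0 mul0r.
  have [r rE] := choice rep.
  exists (\matrix_(i, j) r (coord (vbasis {:L}) j ((P : 'cV[L]_n) i 0))).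
  apply/colP => i; rewrite mxE [RHS](coord_vbasis (memvf _)).
  by apply: eq_bigr => j _; rewrite mxE -rE.
(* Integers that encode no matrix are sent to 0. *)
pose v m := if @unpickle T m is Some X
  then tensor (@FracField.tofrac {poly F}) (pt X) 1 else 0.
exists v; apply: base_change_ind => [|P b x [m xm]].
  by exists 0%N; apply: initial_span0.
have [X XP] := pt_surj P; pose k := pickle X.
have vk : v k = tensor (@FracField.tofrac {poly F}) P 1 by rewrite /v pickleK XP.
exists (maxn m k.+1); apply: initial_spanD.
  have -> : tensor (@FracField.tofrac {poly F}) P b = b *: v k.
    by rewrite vk -[RHS]/(bc_scale _ _) bc_scale_tensor mulr1.
  apply: initial_spanZ; apply: initial_span_mem.
  exact: leq_maxr.
exact: initial_spanS (leq_maxl _ _) xm.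
Qed.
End InfiniteRank.

Theorem theorem3p4 (F : finFieldType) (L : fieldExtType (ratfun F)) (n : nat)
    (n_gt0 : (0 < n)%N) :
  (forall (l : nat) (P : 'I_l -> carlitz_tensor L n),
     lin_indep (fun i => poly_of_point (P i) : Lt_module L) ->
     (forall (i : 'I_l) (w : place L), divides_infty w ->
        (0 < poly_ord w (poly_of_point (P i)))%E) ->
     (forall (i : 'I_l) (w : place L), ~ divides_infty w ->
        ((1 - #|F|%:Z)%:E <= poly_ord w (poly_of_point (P i)))%E) ->
     has_rank (span_of P) l)
  /\ dim_aleph0 (base_change (@FracField.tofrac {poly F})
                   (carlitz_tensor L n)).
Proof.
have inj : injective (@FracField.tofrac {poly F}).
  by move=> f g /eqP; rewrite tofrac_eq => /eqP.
have frac (x : ratfun F) : exists a d, d != 0 /\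
    x * FracField.tofrac d = FracField.tofrac a.
  have [->|/fracP[a [d [_ d0 ->]]]] := eqVneq x 0.
    by exists 0, 1; rewrite oner_neq0 mul0r rmorph0.
  by exists a, d; rewrite divfK ?tofrac_eq0.
split=> [l P indep inf fin|].
  by apply: (has_rank_span inj frac); apply: lin_indep_of_ord.
(* A uniformizer [u] at any finite place supplies the poles of the independent family. *)
have [w wth] := exists_finite_place L; have [u wu] := place_ord_norm w.
have [v v_span] := tensor_countably_spanned L n.
apply: (dim_aleph0_of_seq v_span).
exact: (lin_indep_tensor inj frac (lin_indep_pole_family n_gt0 wth wu)).
Qed.
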